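(* Let $d\in\mathbb{N}$ be fixed and let $X_i$, $i\in\mathbb{N}$, be i.i.d. random variables on $(\Omega,\mathcal{A},\mathbb{P})$ with values in $\mathbb{R}^d$ such that $\mathbb{E}[X_1]=0$ and $\mathbb{E}[\|X_1\|^2]<\infty$. Let $\lambda_1,\ldots,\lambda_d$ be the eigenvalues of $\Gamma=\mathrm{Cov}[X_1]$, let $N_1,\ldots,N_d$ be i.i.d. standard normal random variables, and let $F$ be the distribution function of $V:=\sum_{i=1}^d\lambda_iN_i^2$. Then the bootstrap statistics $V_n^*(\omega)=n\|\overline{\xi}_n(\omega)\|^2$ satisfy, as $n\to\infty$, $$V_n^*(\omega)\stackrel{\mathcal{D}}{\longrightarrow}V\quad\text{for }\mathbb{P}\text{-almost all }\omega\in\Omega$$ (convergence in distribution under $\mathbb{P}^*$), and in fact $$\sup_{x\in\mathbb{R}}|\mathbb{P}^*(V_n^*(\omega)\le x)-F(x)|\to 0,\quad n\to\infty,\quad\text{for }\mathbb{P}\text{-almost all }\omega\in\Omega.$$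
   Context: $\|\cdot\|$ is the Euclidean norm on $\mathbb{R}^d$; eigenvalues are listed with multiplicity. Bootstrap construction: for every $n\in\mathbb{N}$ let $i_{n1},\ldots,i_{nn}$ be random variables on some probability space $(\Omega^*,\mathcal{A}^*,\mathbb{P}^* )$ that are $\mathbb{P}^*$-independent and each uniformly distributed on $\{1,\ldots,n\}$. For $\omega\in\Omega$ and $1\le k\le n$ define $\xi_{nk}(\omega):\Omega^*\to\mathbb{R}^d$ by $\xi_{nk}(\omega)(\omega^* ):=X_{i_{nk}(\omega^* )}(\omega)$. Put $\overline{X}_n(\omega):=n^{-1}\sum_{i=1}^nX_i(\omega)$, $\overline{\xi}_n(\omega):=n^{-1}\sum_{i=1}^n(\xi_{ni}(\omega)-\overline{X}_n(\omega))$ and $V_n^*(\omega):=n\|\overline{\xi}_n(\omega)\|^2$; for each fixed $\omega$, $V_n^*(\omega)$ is a random variable on $(\Omega^*,\mathcal{A}^*,\mathbb{P}^* )$. *)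

(* Defs.v *)
From HB Require Import structures.
From mathcomp Require Import all_boot all_order all_algebra.
From mathcomp Require Import finmap.
From mathcomp Require Import all_classical all_reals all_analysis.
From mathcomp Require Import measurable_realfun.

Set Implicit Arguments.
Unset Strict Implicit.
Unset Printing Implicit Defensive.

Import Order.TTheory GRing.Theory Num.Theory.
Import numFieldNormedType.Exports.

Local Open Scope classical_set_scope.
Local Open Scope ring_scope.

(* The open sets are those of the library topology of 'rV[R]_d, which is the
   usual topology of R^d. *)
Notation borel_rV R d := (g_sigma_algebraType (@open 'rV[R]_d)).

(* The library norm on 'rV[R]_d is the maximum norm, not the Euclidean one. *)
Definition enorm (R : realType) (d : nat) (x : 'rV[R]_d) : R :=
  Num.sqrt (\sum_(j < d) x 0 j ^+ 2).

Definition mutually_independent d d' (T : measurableType d)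
    (S : measurableType d') (R : realType) (P : probability T R)
    (I : choiceType) (Y : I -> {RV P >-> S}) : Prop :=
  forall (J : {fset I}) (A : I -> set S),
    (forall i, i \in J -> measurable (A i)) ->
    P (\bigcap_(i in [set` J]) (Y i @^-1` A i)) =
    (\prod_(i <- J) P (Y i @^-1` A i))%E.

Definition identically_distributed d d' (T : measurableType d)
    (S : measurableType d') (R : realType) (P : probability T R)
    (I : Type) (Y : I -> {RV P >-> S}) : Prop :=
  forall (i j : I) (A : set S), measurable A ->
    distribution P (Y i) A = distribution P (Y j) A.

Definition iid d d' (T : measurableType d) (S : measurableType d')
    (R : realType) (P : probability T R) (I : choiceType)
    (Y : I -> {RV P >-> S}) : Prop :=
  mutually_independent Y /\ identically_distributed Y.

Definition standard_normal d (T : measurableType d) (R : realType)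
    (P : probability T R) (Z : {RV P >-> R}) : Prop :=
  forall A : set R, measurable A -> distribution P Z A = normal_prob 0 1 A.

Definition uniform_below d (T : measurableType d) (R : realType)
    (P : probability T R) (n : nat) (K : {RV P >-> nat}) : Prop :=
  forall m : nat,
    distribution P K [set m] = (if (m < n)%N then n%:R^-1 else 0)%:E.

Definition cov_mx d (T : measurableType d) (R : realType)
    (P : probability T R) (k : nat) (Y : T -> 'rV[R]_k) : 'M[R]_k :=
  \matrix_(i, j) fine (covariance P (fun w => Y w 0 i) (fun w => Y w 0 j)).

Definition eigenvalues_with_mult (R : realType) (k : nat) (A : 'M[R]_k)
    (lambda : 'I_k -> R) : Prop :=
  char_poly A = \prod_(i < k) ('X - (lambda i)%:P).

(* Weak convergence of the laws; Y may live on another probability space. *)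
Definition cvg_in_distribution d d' (T : measurableType d)
    (T' : measurableType d') (R : realType) (P : probability T R)
    (P' : probability T' R) (Y_ : nat -> {RV P >-> R}) (Y : {RV P' >-> R}) :
    Prop :=
  forall f : R -> R, continuous f -> (exists M : R, forall x, `|f x| <= M) ->
    ('E_P[f \o Y_ n])%E @[n --> \oo] --> ('E_P'[f \o Y])%E.

Section weighted_chi_square.
Context d (T : measurableType d) (R : realType) (P : probability T R).
Variables (k : nat) (lambda : 'I_k -> R) (N : 'I_k -> {RV P >-> R}).

Definition weighted_chi2 (w : T) : R := \sum_(i < k) lambda i * N i w ^+ 2.

Lemma measurable_weighted_chi2 : measurable_fun setT weighted_chi2.
Proof.
apply: measurable_sum => i; apply: measurable_funM => //.
exact: measurable_funX.
Qed.

HB.instance Definition _ :=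
  isMeasurableFun.Build _ _ _ _ weighted_chi2 measurable_weighted_chi2.

End weighted_chi_square.

(* Observations and resampling indices are numbered from 0: the sample of size
   n is X 0, ..., X n.-1, and idx n k takes its values in {0, ..., n.-1}
   almost surely. *)
Section bootstrap.
Context (R : realType) (d : nat) (Omega : Type).
Context dS (OmegaS : measurableType dS) (PS : probability OmegaS R).
Variables (X : nat -> Omega -> 'rV[R]_d)
  (idx : forall n : nat, 'I_n -> {RV PS >-> nat}).

Definition sample_mean (n : nat) (w : Omega) : 'rV[R]_d :=
  n%:R^-1 *: \sum_(i < n) X i w.

Definition resample (n : nat) (k : 'I_n) (w : Omega) (ws : OmegaS) :
  'rV[R]_d := X (idx k ws) w.

Definition boot_mean (n : nat) (w : Omega) (ws : OmegaS) : 'rV[R]_d :=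
  n%:R^-1 *: \sum_(k < n) (resample k w ws - sample_mean n w).

Definition boot_stat (n : nat) (w : Omega) (ws : OmegaS) : R :=
  n%:R * enorm (boot_mean n w ws) ^+ 2.

Lemma measurable_boot_stat n w : measurable_fun setT (boot_stat n w).
Proof.
have -> : boot_stat n w = fun ws => n%:R * \sum_(j < d) (n%:R^-1 *
    \sum_(k < n) (X (idx k ws) w 0 j - sample_mean n w 0 j)) ^+ 2.
  apply/funext => ws; rewrite /boot_stat /enorm sqr_sqrtr; last first.
    by apply: sumr_ge0 => j _; exact: sqr_ge0.
  congr (_ * _); apply: eq_bigr => j _; rewrite /boot_mean mxE summxE.
  by congr ((_ * _) ^+ 2); apply: eq_bigr => k _; rewrite !mxE.
apply: measurable_funM => //; apply: measurable_sum => j.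
apply: measurable_funX; apply: measurable_funM => //.
apply: measurable_sum => k; apply: measurable_funB => //.
exact: (measurableT_comp (f := fun m : nat => X m w 0 j)).
Qed.

HB.instance Definition _ n w := isMeasurableFun.Build _ _ _ _
  (boot_stat n w) (measurable_boot_stat n w).

End bootstrap.

(* Main.v *)
Require Import Defs.
From HB Require Import structures.
From mathcomp Require Import all_boot all_order all_algebra.
From mathcomp Require Import finmap ring lra.
From mathcomp Require Import all_classical all_reals all_analysis.
From mathcomp Require Import measurable_realfun.
Set Implicit Arguments.
Unset Strict Implicit.
Unset Printing Implicit Defensive.
Import Order.TTheory GRing.Theory Num.Theory.
Import numFieldNormedType.Exports.
Local Open Scope classical_set_scope.
Local Open Scope ring_scope.

(* For almost every [w] the strong law of large numbers gives convergence of the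
   empirical means to 0 and of the empirical covariances to Gamma; from there on
   [w] is fixed. Choose Q orthogonal with Q Gamma Q^T = diag lambda, and write Y_n
   for sqrt n times the bootstrap mean in this basis. Since exp (- m |y|^2) is the
   average over N of cos (sqrt (2 m) <N, y>), Fubini expresses the Laplace
   transform of V_n^* = |Y_n|^2 through the characteristic functions of the
   one-dimensional variables <t, Y_n>, which are sums of n independent draws from
   a centered array of n reals and converge to exp (- 1/2 sum_j lambda_j t_j^2) by
   Taylor expansion. Averaging over N again, the limit is the Laplace transform of
   V. Polynomials in exp (- v) are uniformly dense among continuous functions of
   exp (- v), so convergence of Laplace transforms on the integers implies weak
   convergence. If some lambda_j is nonzero then V has no atom, and Polya's theorem
   makes the convergence of distribution functions uniform; otherwise the sample
   vanishes almost surely and both distribution functions agree.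

   The strong law is proved for nonnegative pairwise independent variables:
   truncation at level k along k = c 2^l, Borel-Cantelli for each fixed c, and
   monotonicity of the partial sums to interpolate between the subsequences. *)

(** * Bounded expectations and independence *)

(** The exceptional null set must not depend on the direction t. Hence the strong law is applied
    only to coordinates and to products of two coordinates, finitely many functions, and every
    projection inherits its limits by linearity. The resampled values form an array that changes
    with n. Its negligibility condition comes from the strong law as well, since convergence of the
    means of squares forces a_n^2 / n -> 0. A product of n characteristic functions multiplies the
    error of one factor by n, which is why that error is controlled after multiplication by n.
    Everything stays real and scalar: characteristic functions are pairs of expectations of a cosine
    and a sine, and Laplace transforms of nonnegative variables take the place of a d-dimensional
    continuity theorem. Of the normal law only its characteristic function and the absence of atoms
    enter. *)

Section bounded_expectation.
Context d (T : measurableType d) (R : realType) (P : probability T R).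

(** A class closed under sums and products and integrable for every probability, so that
    expectations become linear and monotone real functionals with no other side condition. *)
Definition bmeas (f : T -> R) :=
  measurable_fun setT f /\ exists M, forall x, `|f x| <= M.

Lemma bmeas_integrable f : bmeas f -> P.-integrable setT (EFin \o f).
Proof.
move=> [mf [M fM]]; apply: measurable_bounded_integrable => //.
  by apply: (le_lt_trans (probability_le1 P measurableT)); rewrite ltry.
exists M; split; first exact: num_real.
by move=> x Mx y _ /=; exact: (le_trans (fM y) (ltW Mx)).
Qed.

Lemma bmeas_cst c : bmeas (fun=> c).
Proof. by split=> //; exists `|c|. Qed.

Lemma bmeasD f g : bmeas f -> bmeas g -> bmeas (fun x => f x + g x).
Proof.
move=> [mf [M fM]] [mg [N gN]]; split; first exact: measurable_funD.
by exists (M + N) => x; rewrite (le_trans (ler_normD _ _))// lerD.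
Qed.

Lemma bmeasM f g : bmeas f -> bmeas g -> bmeas (fun x => f x * g x).
Proof.
move=> [mf [M fM]] [mg [N gN]]; split; first exact: measurable_funM.
by exists (M * N) => x; rewrite normrM ler_pM.
Qed.

Lemma bmeasB f g : bmeas f -> bmeas g -> bmeas (fun x => f x - g x).
Proof.
move=> bf [mg [N gN]]; apply: bmeasD bf _; split; first exact: measurableT_comp.
by exists N => x; rewrite normrN.
Qed.

Lemma bmeas_cos f : measurable_fun setT f -> bmeas (fun x => cos (f x)).
Proof.
move=> mf; split; last first.
  by exists 1 => x; rewrite ler_norml cos_geN1 cos_le1.
apply: measurableT_comp => //.
by apply: continuous_measurable_fun; exact: continuous_cos.
Qed.

Lemma bmeas_sin f : measurable_fun setT f -> bmeas (fun x => sin (f x)).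
Proof.
move=> mf; split; last first.
  by exists 1 => x; rewrite ler_norml sin_geN1 sin_le1.
apply: measurableT_comp => //.
by apply: continuous_measurable_fun; exact: continuous_sin.
Qed.

Lemma expect_cst c : \int[P]_x c = c.
Proof. by rewrite Rintegral_cst//= (@probability_setT _ _ _ P) mulr1. Qed.

Lemma expectD f g : bmeas f -> bmeas g ->
  \int[P]_x (f x + g x) = \int[P]_x f x + \int[P]_x g x.
Proof. by move=> bf bg; rewrite RintegralD//; exact: bmeas_integrable. Qed.

Lemma expectB f g : bmeas f -> bmeas g ->
  \int[P]_x (f x - g x) = \int[P]_x f x - \int[P]_x g x.
Proof. by move=> bf bg; rewrite RintegralB//; exact: bmeas_integrable. Qed.

Lemma expectZ c f : bmeas f -> \int[P]_x (c * f x) = c * \int[P]_x f x.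
Proof. by move=> bf; rewrite RintegralZl//; exact: bmeas_integrable. Qed.

Lemma expect_le f g : bmeas f -> bmeas g -> (forall x, f x <= g x) ->
  \int[P]_x f x <= \int[P]_x g x.
Proof. by move=> bf bg fg; apply: le_Rintegral => //; exact: bmeas_integrable. Qed.

Lemma expect_norm_le f (M : R) : bmeas f -> (forall x, `|f x| <= M) ->
  `|\int[P]_x f x| <= M.
Proof.
have bc c : bmeas (fun=> c) by exact: bmeas_cst.
move=> bf fM; rewrite ler_norml; apply/andP; split.
  rewrite -[leLHS]expect_cst; apply: expect_le => // x.
  by have := fM x; rewrite ler_norml => /andP[].
rewrite -[leRHS]expect_cst; apply: expect_le => // x.
by have := fM x; rewrite ler_norml => /andP[].
Qed.

Lemma EFin_expect f : bmeas f ->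
  (\int[P]_x (f x)%:E = (\int[P]_x f x)%R%:E)%E.
Proof.
move=> bf; rewrite /Rintegral fineK//.
exact: integrable_fin_num (bmeas_integrable bf).
Qed.

Lemma cvg_expect_bounded (f_ : nat -> T -> R) (f : T -> R) (M : R) :
  (forall n, measurable_fun setT (f_ n)) -> measurable_fun setT f ->
  (forall n x, `|f_ n x| <= M) ->
  (forall x, f_ n x @[n --> \oo] --> f x) ->
  \int[P]_x f_ n x @[n --> \oo] --> \int[P]_x f x.
Proof.
move=> mf_ mf fM cf.
have ig : P.-integrable setT (EFin \o (fun=> M)).
  by apply: bmeas_integrable; exact: bmeas_cst.
have [If _ cI] : [/\ P.-integrable setT (EFin \o f),
    (\int[P]_x `|(f_ n x)%:E - (f x)%:E| @[n --> \oo] --> 0)%E &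
    (\int[P]_x (f_ n x)%:E @[n --> \oo] --> \int[P]_x (f x)%:E)%E].
  apply: (@dominated_convergence _ _ _ P setT measurableT
      (fun n x => (f_ n x)%:E) (EFin \o f) (EFin \o (fun=> M))) => //.
  - by move=> n; exact/measurable_EFinP.
  - exact/measurable_EFinP.
  - by apply: aeW => x _; apply/cvg_EFin; [exact: nearW|exact: cf].
  - by apply: aeW => x n _; rewrite lee_fin.
apply: fine_cvg; rewrite fineK//.
exact: integrable_fin_num If.
Qed.

End bounded_expectation.

Section independent_pair.
Context d d1 d2 (T : measurableType d) (S1 : measurableType d1)
  (S2 : measurableType d2) (R : realType) (P : probability T R).

Definition indep2 (Y : T -> S1) (W : T -> S2) := forall A B,
  measurable A -> measurable B ->
  (P (Y @^-1` A `&` W @^-1` B) = P (Y @^-1` A) * P (W @^-1` B))%E.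

Variables (Y : {mfun T >-> S1}) (W : {mfun T >-> S2}).
Hypothesis YW : indep2 Y W.

(** The joint law of [Y] and [W] agrees on rectangles with the product of their laws, hence equals
    it; Fubini then integrates one variable at a time. *)
Lemma indep2_integral (h : S1 * S2 -> R) : bmeas h ->
  \int[P]_x h (Y x, W x) = \int[P]_x \int[P]_z h (Y x, W z).
Proof.
move=> bh; have [mh [M hM]] := bh.
pose p x := (Y x, W x).
have mp : measurable_fun setT p by exact: measurable_fun_pair.
pose p' : {mfun T >-> _} := mfun_Sub (mem_set mp).
pose PY : probability S1 R := distribution P Y.
pose PW : probability S2 R := distribution P W.
have law A : measurable A -> (PY \x PW)%E A = distribution P p' A.
  by move=> mA; exact: product_measure_unique.
have bhp : bmeas (h \o p).
  by split; [exact: measurableT_comp|exists M => x; exact: hM].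
have bhy y : bmeas (fun z => h (y, W z)).
  split; last by exists M => x; exact: hM.
  by apply: measurableT_comp => //; exact: measurable_fun_pair.
rewrite {1}/Rintegral -[X in fine X](@integral_distribution _ _ _ _ _ P p' (EFin \o h)); first last.
- exact: bmeas_integrable.
- exact/measurable_EFinP.
rewrite -(@eq_measure_integral _ _ _ setT (distribution P p') (PY \x PW)%E); last first.
  by move=> A mA _; exact: law.
have ih : (PY \x PW)%E.-integrable setT (EFin \o h).
  apply: measurable_bounded_integrable => //.
    by apply: (le_lt_trans (@probability_le1 _ _ _ (PY \x PW)%E _ measurableT)); rewrite ltry.
  exists M; split; first exact: num_real.
  by move=> x Mx y _ /=; exact: (le_trans (hM y) (ltW Mx)).
rewrite -integral12_prod_meas1//.
have FE y : fubini_F PW (EFin \o h) y = (\int[P]_z h (y, W z))%:E.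
  rewrite -EFin_expect// /fubini_F.
  rewrite (@integral_distribution _ _ _ _ _ P W (fun z => (h (y, z))%:E))//.
    by apply/measurable_EFinP; apply: measurableT_comp => //; exact: measurable_fun_pair.
  exact: (bmeas_integrable P (bhy y)).
have mF := measurable_fubini_F ih.
have bF : bmeas (fun x => \int[P]_z h (Y x, W z)).
  split; last by exists M => x; exact: expect_norm_le.
  apply/measurable_EFinP.
  rewrite (_ : EFin \o _ = fubini_F PW (EFin \o h) \o Y); first exact: measurableT_comp.
  by apply/funext => x /=; rewrite FE.
rewrite integral_distribution//; last first.
  rewrite (_ : _ \o _ = EFin \o (fun x => \int[P]_z h (Y x, W z))); last first.
    by apply/funext => x /=; rewrite FE.
  exact: bmeas_integrable.
by congr fine; apply: eq_integral => x _ /=; rewrite FE.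
Qed.

End independent_pair.

Section independent_real_pair.
Context d d1 d2 (T : measurableType d) (S1 : measurableType d1)
  (S2 : measurableType d2) (R : realType) (P : probability T R).

Lemma indep2_expectM (Y : {mfun T >-> S1}) (W : {mfun T >-> S2})
    (f : S1 -> R) (g : S2 -> R) : indep2 P Y W -> bmeas f -> bmeas g ->
  \int[P]_x (f (Y x) * g (W x)) = \int[P]_x f (Y x) * \int[P]_x g (W x).
Proof.
move=> YW [mf [M fM]] [mg [N gN]].
have bfY : bmeas (f \o Y) by split; [exact: measurableT_comp|exists M => x; exact: fM].
have bgW : bmeas (g \o W) by split; [exact: measurableT_comp|exists N => x; exact: gN].
rewrite (@indep2_integral _ _ _ _ _ _ _ P Y W YW (fun z => f z.1 * g z.2)); last first.
  by apply: bmeasM; split; [exact: measurableT_comp|exists M => x; exact: fM|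
    exact: measurableT_comp|exists N => x; exact: gN].
under eq_Rintegral => x _ do rewrite /= (expectZ _ _ bgW) mulrC.
by rewrite expectZ// mulrC.
Qed.

Lemma indep2_comp d3 d4 (S3 : measurableType d3) (S4 : measurableType d4)
    (Y : T -> S1) (W : T -> S2) (f : S1 -> S3) (g : S2 -> S4) :
  measurable_fun setT f -> measurable_fun setT g ->
  indep2 P Y W -> indep2 P (f \o Y) (g \o W).
Proof.
move=> mf mg YW A B mA mB; apply: (YW (f @^-1` A) (g @^-1` B)).
  by rewrite -[X in measurable X]setTI; exact: mf.
by rewrite -[X in measurable X]setTI; exact: mg.
Qed.

End independent_real_pair.

Section mutual_independence.
Context d d' (T : measurableType d) (S : measurableType d') (R : realType)
  (P : probability T R) (I : choiceType) (Y : I -> {mfun T >-> S}).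
Hypothesis indY : mutually_independent (P := P) Y.

Lemma mutually_independent_pair i j : i != j -> indep2 P (Y i) (Y j).
Proof.
move=> ij A B mA mB.
pose C k := if k == i then A else B.
have /= := indY (J := [fset i; j]%fset) (A := C) _.
rewrite bigcap_fset big_fsetU1 ?inE//= big_seq_fset1 !big_fsetU1 ?inE//= !big_seq_fset1.
rewrite /C eqxx eq_sym (negbTE ij); apply => k _.
by case: ifP.
Qed.

(** Cylinder events over [s]: a pi-system generating the sigma-algebra of the variables [Y i] with
    [i] in [s]. *)
Let rect (s : {fset I}) (E : set T) : Prop := exists A : I -> set S,
  (forall i, measurable (A i)) /\ E = \bigcap_(i in [set` s]) (Y i @^-1` A i).

Let rectI s : setI_closed (rect s).
Proof.
move=> E F [A [mA ->]] [B [mB ->]]; exists (fun i => A i `&` B i); split.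
  by move=> i; exact: measurableI.
by rewrite -bigcapI.
Qed.

Let rect_measurable s : rect s `<=` measurable.
Proof.
move=> E [A [mA ->]]; apply: fin_bigcap_measurable => // i _.
exact: measurable_funPTI.
Qed.

(** Mutual independence over [s] with [k] adjoined and over [s] alone gives two products that differ
    exactly by the factor of index [k]. *)
Let rect_indep (s : {fset I}) (k : I) (A : set S) (E : set T) : k \notin s ->
  measurable A -> rect s E -> (P (Y k @^-1` A `&` E) = P (Y k @^-1` A) * P E)%E.
Proof.
move=> ks mA [B [mB ->]].
pose C i := if i == k then A else B i.
have mC i : measurable (C i) by rewrite /C; case: ifP.
have CB i : i \in s -> C i = B i.
  by move=> si; rewrite /C; case: eqVneq => // ik; rewrite -ik si in ks.
rewrite (indY (J := s) (fun i _ => mB i)).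
have := indY (J := (k |` s)%fset) (fun i _ => mC i).
rewrite bigcap_fset big_fsetU1// big_fsetU1// -bigcap_fset /=.
rewrite (_ : C k = A); last by rewrite /C eqxx.
rewrite (_ : \bigcap_(i in [set` s]) _ = \bigcap_(i in [set` s]) Y i @^-1` B i); last first.
  by apply: eq_bigcapr => i si; rewrite CB.
move=> ->; congr (_ * _)%E; rewrite big_seq [RHS]big_seq.
by apply: eq_bigr => i si; rewrite CB.
Qed.

(** The sum is measurable for the sigma-algebra generated by the cylinders over [s], and the events
    independent of [Y k] form a Dynkin system containing these cylinders. *)
Lemma mutually_independent_sum (k : I) (s : seq I) (g : I -> S -> R) :
  k \notin s -> (forall i, measurable_fun setT (g i)) ->
  indep2 P (Y k) (fun x => \sum_(i <- s) g i (Y i x)).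
Proof.
move=> ks mg A B mA mB.
pose J := [fset i in s]%fset.
have kJ : k \notin J by rewrite inE.
(* [T'] is [T] with the coarser sigma-algebra of the cylinders. *)
pose T' := g_sigma_algebraType (rect J).
have mY i : i \in s -> measurable_fun [set: T'] (Y i : T' -> S).
  move=> si _ C mC; rewrite setTI; apply: sub_sigma_algebra.
  exists (fun j => if j == i then C else setT); split.
    by move=> j; case: ifP.
  apply/seteqP; split => [x Cx j /= js|x /(_ i)/=].
    by case: eqVneq => // ->.
  by rewrite eqxx; apply; rewrite inE.
have mW : measurable_fun [set: T'] ((fun x => \sum_(i <- s) g i (Y i x)) : T' -> R).
  (* Outside [s] the functions [Y i] are not known to be measurable on [T']; the summands of these
     indices, which do not occur, are replaced by 0. *)
  rewrite (_ : (fun x => _) = fun x => \sum_(i <- s) if i \in s then g i (Y i x) else 0).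
    apply: measurable_sum => i; case: (boolP (i \in s)) => // si.
    by apply: (measurableT_comp (f := g i)); [exact: mg|exact: mY].
  by apply/funext => x; rewrite big_seq [RHS]big_seq; apply: eq_bigr => i ->.
have mT' E : <<s rect J >> E -> measurable E.
  apply: smallest_sub; [exact: sigma_algebra_measurable|exact: rect_measurable].
have mYA : measurable (Y k @^-1` A) by exact: measurable_funPTI.
suff H E : <<s rect J >> E -> (P (Y k @^-1` A `&` E) = P (Y k @^-1` A) * P E)%E.
  by apply: H; rewrite -[X in <<s _ >> X]setTI; exact: mW.
pose Q (E : set T) := (P (Y k @^-1` A `&` E) = P (Y k @^-1` A) * P E)%E.
have QC (F : set T) : measurable F -> Q F -> Q (~` F).
  move=> mF QF; rewrite /Q -setDE measureD//; last first.
    by apply: (le_lt_trans (probability_le1 P _)); rewrite ?ltry.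
  rewrite [X in (_ - X)%E]QF probability_setC// muleBr ?mule1//.
  exact: fin_num_measure.
have Qbigcup (F : (set T)^nat) : (forall n, measurable (F n)) ->
    trivIset setT F -> (forall n, Q (F n)) -> Q (\bigcup_n F n).
  move=> mF tF QF; rewrite /Q setI_bigcupr !measure_bigcup//; last 2 first.
  + by move=> n _; exact: measurableI.
  + by apply: trivIset_setIl.
  have fY : P (Y k @^-1` A) \is a fin_num by exact: fin_num_measure.
  rewrite -[X in (X * _)%E](fineK fY) -nneseriesZl//.
  by apply: eq_eseriesr => n _; rewrite fineK//; exact: QF.
apply: (@dynkin_induction _ T' (rect J) Q) => //.
- by rewrite /Q setIT (@probability_setT _ _ _ P) mule1.
- by move=> F; exact: rect_indep.
- by move=> F /mT' mF; exact: QC.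
- by move=> F mF tF QF; apply: Qbigcup => // n; exact: (mT' _ (mF n)).
Qed.

End mutual_independence.

(** * The strong law of large numbers *)

Section prob_expect.
Context d (T : measurableType d) (R : realType) (P : probability T R).

Lemma bmeas_indic (A : set T) : measurable A -> bmeas (R := R) \1_A.
Proof.
move=> mA; split; first exact: measurable_indic.
by exists 1 => x; rewrite ger0_norm// indicE; case: (_ \in _).
Qed.

Lemma expect_indic (A : set T) : measurable A ->
  (\int[P]_x (\1_A x : R))%:E = P A.
Proof.
move=> mA; rewrite -EFin_expect; last exact: bmeas_indic.
by rewrite integral_indic// setIT.
Qed.

Lemma expect_sum (I : Type) (s : seq I) (f : I -> T -> R) :
  (forall i, bmeas (f i)) ->
  bmeas (fun x => \sum_(i <- s) f i x) /\
  \int[P]_x (\sum_(i <- s) f i x) = \sum_(i <- s) \int[P]_x f i x.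
Proof.
move=> bf; elim: s => [|i s [bs IH]].
  under eq_Rintegral => x _ do rewrite big_nil.
  under eq_fun do rewrite big_nil.
  by rewrite expect_cst big_nil; split=> //; exact: bmeas_cst.
under eq_Rintegral => x _ do rewrite big_cons.
under eq_fun do rewrite big_cons.
by split; [exact: bmeasD|rewrite expectD// IH big_cons].
Qed.

End prob_expect.

(** * Deviation bound for averages through truncation *)

Section truncated_weak_law.
Context d (T : measurableType d) (R : realType) (P : probability T R).
Variable Z : nat -> {mfun T >-> R}.
Hypothesis Z0 : forall i x, 0 <= Z i x.
Hypothesis indZ : forall i j, i != j -> indep2 P (Z i) (Z j).
Hypothesis idZ : forall i A, measurable A -> P (Z i @^-1` A) = P (Z 0%N @^-1` A).

Lemma expect_id i (f : R -> R) : bmeas f ->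
  \int[P]_x f (Z i x) = \int[P]_x f (Z 0%N x).
Proof.
move=> [mf [M fM]].
have E j : (\int[P]_x (f (Z j x))%:E = \int[distribution P (Z j)]_y (f y)%:E)%E.
  rewrite integral_distribution//; first exact/measurable_EFinP.
  apply: bmeas_integrable; split; first exact: measurableT_comp.
  by exists M => x; exact: fM.
rewrite /Rintegral !E; congr fine; apply: eq_measure_integral => A mA _.
exact: idZ.
Qed.

(** Either some [Z i] exceeds [k], or the sum equals the sum of the truncated variables and
    Chebyshev applies, with variances bounded by truncated second moments. Both cases cost a
    multiple of the same integral: 1 for the exceedance, [e ^- 2] for Chebyshev. *)
Lemma truncated_deviation (k : nat) (e : R) : (0 < k)%N -> 0 < e ->
  (P [set x | (e <= `|k%:R^-1 * \sum_(i < k) Z i x -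
       \int[P]_y Num.min (Z 0%N y) k%:R|)%R] <=
  ((1 + e ^- 2) * (\int[P]_x (Num.min (Z 0%N x) k%:R ^+ 2 / k%:R)))%:E)%E.
Proof.
move=> k0 e0.
have k0R : 0 < k%:R :> R by rewrite ltr0n.
have mmin : measurable_fun setT (fun z : R => Num.min z k%:R).
  by apply: (measurable_minr (f := idfun) (g := cst k%:R)); [exact: measurable_id|].
have min_ge0 i x : 0 <= Num.min (Z i x) k%:R.
  by rewrite le_min Z0/= ltW.
have min_lek i x : Num.min (Z i x) k%:R <= k%:R by rewrite ge_min lexx orbT.
pose m := \int[P]_y Num.min (Z 0%N y) k%:R.
(* Truncation from above alone is unbounded below on the line; [clip] is bounded and has the same
   values at the nonnegative [Z i]. *)
pose clip (z : R) : R := Num.max 0 (Num.min z k%:R).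
have bclip : bmeas clip.
  split; first by apply: (measurable_maxr (f := cst 0)).
  exists k%:R => z; rewrite ger0_norm; first by rewrite ge_max ltW//= ge_min lexx orbT.
  by rewrite le_max lexx.
have clipE i x : Num.min (Z i x) k%:R = clip (Z i x).
  by rewrite /clip max_r.
pose U (i : nat) x := Num.min (Z i x) k%:R - m.
have bmin i : bmeas (fun x => Num.min (Z i x) k%:R).
  split; first by apply: (measurableT_comp (f := fun z : R => Num.min z k%:R)).
  by exists k%:R => x; rewrite ger0_norm.
have bU i : bmeas (U i) by apply: bmeasB => //; exact: bmeas_cst.
have Emin i : \int[P]_x Num.min (Z i x) k%:R = m.
  under eq_Rintegral => x _ do rewrite clipE.
  by rewrite expect_id//; under eq_Rintegral => x _ do rewrite -clipE.
have EU i : \int[P]_x U i x = 0.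
  by rewrite expectB ?Emin ?expect_cst ?subrr//; exact: bmeas_cst.
have bsq f : bmeas f -> bmeas (fun x : T => f x ^+ 2).
  by move=> bf; under eq_fun do rewrite expr2; exact: bmeasM.
pose v := \int[P]_x (Num.min (Z 0%N x) k%:R ^+ 2).
have Esq i : \int[P]_x (Num.min (Z i x) k%:R ^+ 2) = v.
  under eq_Rintegral => x _ do rewrite clipE.
  rewrite (@expect_id i (fun z => clip z ^+ 2)).
    by rewrite /v; under [RHS]eq_Rintegral => x _ do rewrite clipE.
  by under eq_fun do rewrite expr2; exact: bmeasM.
have EUU i j : i != j -> \int[P]_x (U i x * U j x) = 0.
  move=> ij; rewrite /U.
  have bc : bmeas (fun z => clip z - m) by apply: bmeasB => //; exact: bmeas_cst.
  under eq_Rintegral => x _ do rewrite !clipE.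
  rewrite (indep2_expectM (indZ ij) bc bc).
  under eq_Rintegral => x _ do rewrite -clipE.
  by rewrite -/(U i) EU mul0r.
have EU2 i : \int[P]_x (U i x ^+ 2) <= v.
  have : \int[P]_x (U i x ^+ 2) = v - m ^+ 2.
    transitivity (\int[P]_x (Num.min (Z i x) k%:R ^+ 2 -
                    (2 * m * Num.min (Z i x) k%:R - m ^+ 2))).
      by apply: eq_Rintegral => x _; rewrite /U; ring.
    have b1 : bmeas (fun x => 2 * m * Num.min (Z i x) k%:R).
      by apply: bmeasM => //; exact: bmeas_cst.
    have b2 : bmeas (fun x : T => m ^+ 2) by exact: bmeas_cst.
    rewrite expectB//; [|exact: bsq|exact: bmeasB].
    by rewrite Esq expectB// expectZ// Emin expect_cst; ring.
  by move=> ->; rewrite lerBlDr lerDl sqr_ge0.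
pose W x := \sum_(i < k) U i x.
have bW : bmeas W by have [] := expect_sum P (index_enum 'I_k) (fun i : 'I_k => bU i).
have EW2 : \int[P]_x (W x ^+ 2) <= k%:R * v.
  have -> : \int[P]_x (W x ^+ 2) = \sum_(i < k) \sum_(j < k) \int[P]_x (U i x * U j x).
    under eq_Rintegral => x _ do rewrite expr2 mulr_suml.
    under eq_Rintegral => x _ do under eq_bigr do rewrite mulr_sumr.
    have bij (i j : 'I_k) : bmeas (fun x => U i x * U j x) by exact: bmeasM.
    have bi (i : 'I_k) : bmeas (fun x => \sum_(j < k) U i x * U j x).
      by have [] := expect_sum P (index_enum 'I_k) (bij i).
    have [_ ->] := expect_sum P (index_enum 'I_k) bi.
    by apply: eq_bigr => i _; have [_ ->] := expect_sum P (index_enum 'I_k) (bij i).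
  rewrite (_ : k%:R * v = \sum_(i < k) v); last by rewrite sumr_const card_ord mulr_natl.
  apply: ler_sum => i _; rewrite (bigD1 i)//= big1 ?addr0; last first.
    by move=> j ji; rewrite EUU// eq_sym.
  by under eq_Rintegral => x _ do rewrite -expr2; exact: EU2.
set A := [set x | _].
have mA : measurable A.
  rewrite /A -[X in measurable X]setTI.
  apply: (@measurable_fun_le _ _ _ setT (cst e)) => //.
  apply: measurableT_comp => //; apply: measurable_funB => //.
  by apply: measurable_funM => //; exact: measurable_sum.
rewrite -expect_indic// lee_fin.
(* A majorant of the indicator of [A]: the first term is at least 1 as soon as one [Z i] exceeds
   [k], the second one on the rest of [A]. *)
pose B x := k%:R ^- 2 * (\sum_(i < k) Num.min (Z i x) k%:R ^+ 2) +
  (k%:R * e) ^- 2 * W x ^+ 2.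
have bS (i : 'I_k) : bmeas (fun x => Num.min (Z i x) k%:R ^+ 2) by exact: bsq.
have [bSS ESS] := expect_sum P (index_enum 'I_k) bS.
have bB1 : bmeas (fun x => k%:R ^- 2 * (\sum_(i < k) Num.min (Z i x) k%:R ^+ 2)).
  by apply: bmeasM => //; exact: bmeas_cst.
have bB2 : bmeas (fun x => (k%:R * e) ^- 2 * W x ^+ 2).
  by apply: bmeasM => //; [exact: bmeas_cst|exact: bsq].
have AB x : \1_A x <= B x.
  have B1 : 0 <= k%:R ^- 2 * (\sum_(i < k) Num.min (Z i x) k%:R ^+ 2).
    by rewrite mulr_ge0// ?invr_ge0 ?sqr_ge0// sumr_ge0// => i _; exact: sqr_ge0.
  have B2 : 0 <= (k%:R * e) ^- 2 * W x ^+ 2 by rewrite mulr_ge0// ?invr_ge0 ?sqr_ge0.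
  rewrite indicE; have [|_] := boolP (x \in A); last by rewrite addr_ge0.
  rewrite inE /A/= => Ax.
  have [[i kZ]|noZ] := pselect (exists i : 'I_k, k%:R < Z i x).
    rewrite -[leLHS]addr0 lerD// mulrC ler_pdivlMr ?exprn_gt0// mul1r.
    rewrite (bigD1 i)//= -[leLHS]addr0 lerD//; last by rewrite sumr_ge0// => j _; exact: sqr_ge0.
    by rewrite min_r// ltW.
  rewrite -[leLHS]add0r lerD// mulrC ler_pdivlMr ?exprn_gt0 ?mulr_gt0// mul1r.
  rewrite -[leRHS]real_normK ?num_real// ler_pXn2r// ?nnegrE ?mulr_ge0 ?(ltW e0)//.
  have -> : W x = k%:R * (k%:R^-1 * (\sum_(i < k) Z i x) - m).
    rewrite mulrBr mulrA divff ?gt_eqF// mul1r /W /U sumrB sumr_const card_ord -[m *+ k]mulr_natl.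
    congr (_ - _); apply: eq_bigr => i _; rewrite min_l// leNgt; apply/negP => kZ.
    by apply: noZ; exists i.
  by rewrite normrM ger0_norm// ler_pM2l.
apply: (@le_trans _ _ (\int[P]_x B x)).
  by apply: expect_le => //; [exact: bmeas_indic|exact: bmeasD].
rewrite expectD// !expectZ//; last exact: bsq.
rewrite ESS; under eq_bigr do rewrite Esq.
rewrite sumr_const card_ord -[v *+ k]mulr_natl.
have -> : \int[P]_x (Num.min (Z 0%N x) k%:R ^+ 2 / k%:R) = v / k%:R.
  under eq_Rintegral => x _ do rewrite mulrC.
  by rewrite expectZ; [rewrite mulrC|exact: bsq].
rewrite mulrDl mul1r lerD//.
  by rewrite le_eqVlt; apply/orP; left; apply/eqP; field; rewrite gt_eqF.
apply: (@le_trans _ _ ((k%:R * e) ^- 2 * (k%:R * v))).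
  by rewrite ler_wpM2l// invr_ge0 sqr_ge0.
rewrite le_eqVlt; apply/orP; left; apply/eqP.
by field; rewrite !gt_eqF.
Qed.

End truncated_weak_law.

(** Levels below [x] contribute themselves, a geometric sum of at most twice its last term, hence at
    most 2 x. Levels above [x] contribute x^2 over the level, a geometric sum of at most twice its
    first term, again at most 2 x. *)
Lemma dyadic_truncation_sum (R : realType) (x k : R) (L : nat) : 0 <= x -> 0 < k ->
  \sum_(l < L) Num.min x (k * 2 ^+ l) ^+ 2 / (k * 2 ^+ l) <= 4 * x.
Proof.
move=> x0 k0.
(* The bound carried by the induction on [L], with [k] doubling at each step. *)
pose g (k : R) := if x <= k then 2 * x ^+ 2 / k else 4 * x - 2 * k.
have g4 k' : 0 < k' -> g k' <= 4 * x.
  move=> k'0; rewrite /g; case: ifPn => [xk|_]; last by rewrite lerBlDr lerDl mulr_ge0// ltW.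
  by rewrite ler_pdivrMr//; nra.
apply: (le_trans _ (g4 _ k0)); elim: L k k0 => [|L IH] k k0.
  rewrite big_ord0 /g; case: ifPn => [xk|]; first by apply: divr_ge0; [rewrite mulr_ge0 ?sqr_ge0|exact: ltW].
  by rewrite -ltNge => kx; lra.
rewrite big_ord_recl expr0 mulr1.
under eq_bigr => i _ do rewrite lift0 (exprS 2 i) mulrA.
have k20 : 0 < k * 2 by rewrite mulr_gt0.
apply: (le_trans (lerD (lexx _) (IH _ k20))); rewrite /g.
have kn0 : k != 0 by rewrite gt_eqF.
case: (leP x k) => xk.
  rewrite (_ : x <= k * 2)//; last by lra.
  rewrite le_eqVlt; apply/orP; left; apply/eqP; field.
  by [].
case: (leP x (k * 2)) => xk2.
  rewrite -subr_ge0.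
  have -> : 4 * x - 2 * k - (k ^+ 2 / k + 2 * x ^+ 2 / (k * 2)) =
     (x - k) * (3 * k - x) / k by field.
  by apply: divr_ge0; [nra|exact: ltW].
rewrite -subr_ge0.
have -> : 4 * x - 2 * k - (k ^+ 2 / k + (4 * x - 2 * (k * 2))) = k by field.
exact: ltW.
Qed.

Section dyadic_subsequences.
Context d (T : measurableType d) (R : realType) (P : probability T R).
Variable Z : nat -> {mfun T >-> R}.
Hypothesis Z0 : forall i x, 0 <= Z i x.
Hypothesis indZ : forall i j, i != j -> indep2 P (Z i) (Z j).
Hypothesis idZ : forall i A, measurable A -> P (Z i @^-1` A) = P (Z 0%N @^-1` A).
Hypothesis iZ : P.-integrable setT (EFin \o Z 0%N).

Lemma cvg_expect_min (k : nat -> nat) : (forall l, l <= k l)%N ->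
  \int[P]_x Num.min (Z 0%N x) (k l)%:R @[l --> \oo] --> \int[P]_x Z 0%N x.
Proof.
move=> lk.
have [If _ cI] : [/\ P.-integrable setT (EFin \o Z 0%N),
    (\int[P]_x `|(Num.min (Z 0%N x) (k l)%:R)%:E - (Z 0%N x)%:E| @[l --> \oo] --> 0)%E &
    (\int[P]_x (Num.min (Z 0%N x) (k l)%:R)%:E @[l --> \oo] --> \int[P]_x (Z 0%N x)%:E)%E].
  apply: (@dominated_convergence _ _ _ P setT measurableT
      (fun l x => (Num.min (Z 0%N x) (k l)%:R)%:E) (EFin \o Z 0%N) (EFin \o Z 0%N)) => //.
  - by move=> l; apply/measurable_EFinP; apply: (measurable_minr (g := cst (k l)%:R)).
  - exact/measurable_EFinP.
  - apply: aeW => x _; have [n Zn] : exists n : nat, Z 0%N x <= n%:R.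
      by exists (Num.truncn (Z 0%N x)).+1; rewrite ltW// truncnS_gt.
    apply: cvg_near_cst; near=> l; rewrite min_l//.
    apply: (le_trans Zn); rewrite ler_nat (leq_trans _ (lk l))//.
    near: l; exact: nbhs_infty_ge.
  - apply: aeW => x n _; rewrite lee_fin ger0_norm ?ge_min ?lexx//.
    by rewrite le_min Z0 ler0n.
apply: fine_cvg; rewrite fineK//.
exact: integrable_fin_num If.
Unshelve. all: by end_near. Qed.

Lemma dyadic_strong_law (c : nat) : (0 < c)%N ->
  {ae P, forall x, (c * 2 ^ l)%:R^-1 * \sum_(i < c * 2 ^ l) Z i x
     @[l --> \oo] --> \int[P]_x Z 0%N x}.
Proof.
move=> c0; pose k l := (c * 2 ^ l)%N.
have k0 l : (0 < k l)%N by rewrite muln_gt0 c0 expn_gt0.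
have kR l : (k l)%:R = c%:R * 2 ^+ l :> R by rewrite /k natrM natrX.
pose m l := \int[P]_x Num.min (Z 0%N x) (k l)%:R.
(* The tolerances 1 / (p + 1) form a countable family, so the exceptional sets of all of them have a
   null union. *)
pose A (p l : nat) := [set x | p.+1%:R^-1 <= `|(k l)%:R^-1 * \sum_(i < k l) Z i x - m l|].
have mA p l : measurable (A p l).
  rewrite /A -[X in measurable X]setTI.
  apply: (@measurable_fun_le _ _ _ setT (cst p.+1%:R^-1)) => //.
  apply: measurableT_comp => //; apply: measurable_funB => //.
  by apply: measurable_funM => //; exact: measurable_sum.
have A_fin p : (\sum_(l <oo) P (A p l) < +oo)%E.
  (* The first factor is that of the deviation bound at tolerance 1 / (p + 1); the 4 is that of the
     dyadic sum, applied pointwise under the integral. *)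
  pose C := (1 + p.+1%:R^-1 ^- 2) * (4 * \int[P]_x Z 0%N x).
  apply: (@le_lt_trans _ _ C%:E); last exact: ltry.
  apply: lime_le; first exact: is_cvg_nneseries.
  apply: nearW => L; rewrite big_mkord.
  apply: (@le_trans _ _ (\sum_(l < L) ((1 + p.+1%:R^-1 ^- 2) *
      (\int[P]_x (Num.min (Z 0%N x) (k l)%:R ^+ 2 / (k l)%:R)))%:E)%E).
    by apply: lee_sum => l _; apply: truncated_deviation => //; rewrite invr_gt0.
  rewrite sumEFin lee_fin -mulr_sumr; apply: ler_wpM2l.
    by rewrite addr_ge0// exprVn invrK exprn_ge0.
  have b l : bmeas (fun x => Num.min (Z 0%N x) (k l)%:R ^+ 2 / (k l)%:R).
    apply: bmeasM; last exact: bmeas_cst.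
    have bm : bmeas (fun x => Num.min (Z 0%N x) (k l)%:R).
      split; first by apply: (measurable_minr (g := cst (k l)%:R)).
      exists (k l)%:R => x; rewrite ger0_norm ?le_min ?Z0 ?ler0n//.
      by rewrite ge_min lexx orbT.
    by under eq_fun do rewrite expr2; exact: bmeasM.
  have [bS <-] := expect_sum P (index_enum 'I_L) (fun l : 'I_L => b l).
  rewrite -RintegralZl//; apply: le_Rintegral => //.
  - exact: bmeas_integrable.
  - exact: (@integrableZl _ _ _ _ _ _ 4 (EFin \o Z 0%N)).
  - move=> x _; under eq_bigr do rewrite kR.
    by apply: dyadic_truncation_sum => //; rewrite ltr0n.
have A0 p : P (lim_sup_set (A p)) = 0%E.
  by apply: lim_sup_set_cvg0 => //; exact: A_fin.
have : {ae P, forall x, forall p, ~ lim_sup_set (A p) x}.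
  apply: ae_foralln => p; exists (lim_sup_set (A p)); split.
  - by apply: bigcap_measurable => // n _; exact: bigcup_measurable.
  - exact: A0.
  - by move=> x /= /contrapT.
apply: filterS => x xA.
suff : ((k l)%:R^-1 * \sum_(i < k l) Z i x - m l) + m l @[l --> \oo] --> 0 + \int[P]_x Z 0%N x.
  by rewrite add0r; under eq_fun do rewrite subrK.
apply: cvgD; last first.
  by apply: cvg_expect_min => l; rewrite (leq_trans (ltnW (ltn_expl l (ltnSn 1))))// leq_pmull.
apply/cvgr0Pnorm_lt => e e0.
have [p pe] : exists p : nat, p.+1%:R^-1 < e.
  exists (Num.truncn e^-1); rewrite invf_plt ?posrE//; exact: truncnS_gt.
have [n [_ nA]] : exists n, True /\ forall j, (n <= j)%N -> ~ A p j x.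
  have /existsNP[n /not_implyP[_ nA]] := xA p.
  exists n; split => // j nj Aj; apply: nA; exists j => //.
near=> l; apply: lt_trans pe; rewrite ltNge; apply/negP.
apply: nA; near: l; exact: nbhs_infty_ge.
Unshelve. all: by end_near. Qed.

End dyadic_subsequences.

(** Choose q = 2^l so that the integer part c of n / q satisfies N + 1 <= c < 2 (N + 1). Then S n
    lies between S (c q) and S ((c + 1) q), whose arguments have ratio at most 1 + 1 / (N + 1), and
    for a given N only finitely many c occur. *)
Lemma dyadic_interpolation (R : realType) (S : nat -> R) (mu : R) :
  (forall n, 0 <= S n) -> {homo S : m n / (m <= n)%N >-> m <= n} ->
  (forall c, (0 < c)%N -> (c * 2 ^ l)%:R^-1 * S (c * 2 ^ l)%N @[l --> \oo] --> mu) ->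
  n%:R^-1 * S n @[n --> \oo] --> mu.
Proof.
move=> S0 Smono Scvg.
have mu0 : 0 <= mu.
  have cvg1 := Scvg 1%N (ltnSn 0).
  apply: (cvgr_to_ge cvg1); apply: nearW => l.
  by rewrite mulr_ge0// invr_ge0.
apply/cvgrPdist_le => e e0.
(* For c > N this yields mu + e <= (e / 2) c, which absorbs the rounding of n to a multiple of q. *)
have [N Ne] : exists N : nat, (mu + e) <= (e / 2) * N.+1%:R.
  exists (Num.truncn ((mu + e) / (e / 2))).
  by rewrite mulrC -ler_pdivrMr ?divr_gt0// ltW// truncnS_gt.
(* Indices run up to 2 (N + 1) inclusive because both c < 2 (N + 1) and c + 1 are used. *)
have : \forall l \near \oo, forall c : 'I_(2 * N.+1).+1, (0 < c)%N ->
    `|mu - (c * 2 ^ l)%:R^-1 * S (c * 2 ^ l)%N| <= e / 2.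
  apply: filter_forall => c; have [->|c0] := posnP c; first exact: nearW.
  have /cvgrPdist_le/(_ (e / 2)) := Scvg _ c0.
  by move=> /(_ ltac:(by rewrite divr_gt0)); apply: filterS.
move=> [L _ HL]; exists (N.+1 * 2 ^ L)%N => // n /= nL.
have n0 : (0 < n)%N by rewrite (leq_trans _ nL)// muln_gt0 expn_gt0.
pose l := trunc_log 2 (n %/ N.+1).
have nN0 : (0 < n %/ N.+1)%N.
  by rewrite divn_gt0// (leq_trans _ nL)// leq_pmulr// expn_gt0.
have Ll : (L <= l)%N by apply: trunc_log_max => //; rewrite leq_divRL// mulnC.
have /andP[l1 l2] : (2 ^ l <= n %/ N.+1 < 2 ^ l.+1)%N by exact: trunc_log_bounds.
rewrite leq_divRL// in l1; rewrite ltn_divLR// in l2.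
pose q := (2 ^ l)%N; pose c := (n %/ q)%N.
have q0 : (0 < q)%N by rewrite expn_gt0.
have Nc : (N.+1 <= c)%N by rewrite leq_divRL// mulnC.
have cN : (c < 2 * N.+1)%N by rewrite ltn_divLR// mulnAC -expnS.
have cq : (c * q <= n)%N by exact: leq_trunc_div.
have qc : (n <= c.+1 * q)%N by rewrite ltnW// ltn_ceil.
have := HL l Ll (inord c); rewrite inordK ?(ltn_trans cN)// => /(_ (leq_trans (ltn0Sn N) Nc)) Hc.
have := HL l Ll (inord c.+1); rewrite inordK ?ltnS// => /(_ isT) Hc1.
rewrite -/q in Hc Hc1.
have nR : 0 < n%:R :> R by rewrite ltr0n.
have qR : 0 < q%:R :> R by rewrite ltr0n.
have NcR : N.+1%:R <= c%:R :> R by rewrite ler_nat.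
have cR : 0 < c%:R :> R by rewrite ltr0n (leq_trans _ Nc).
have cqR : c%:R * q%:R <= n%:R :> R by rewrite -natrM ler_nat.
have qcR : n%:R <= (c%:R + 1) * q%:R :> R by rewrite natr1 -natrM ler_nat.
have natE : (c.+1 * q)%:R = (c%:R + 1) * q%:R :> R by rewrite natrM natr1.
have c1R : 0 < (c%:R + 1) * q%:R :> R by rewrite -natE ltr0n muln_gt0.
have S1 : S (c * q)%N <= S n by exact: Smono.
have S2 : S n <= S (c.+1 * q)%N by exact: Smono.
have {}Ne : mu + e <= (e / 2) * c%:R.
  by apply: (le_trans Ne); rewrite ler_pM2l// divr_gt0.
have {Hc} Sc : (mu - e / 2) * (c%:R * q%:R) <= S (c * q)%N.
  have : mu - e / 2 <= (c * q)%:R^-1 * S (c * q)%N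
    by move: Hc; set a := _ * S _; rewrite ler_norml => /andP[]; lra.
  by rewrite [X in _ <= X -> _]mulrC ler_pdivlMr natrM ?mulr_gt0.
have {Hc1} Sc1 : S (c.+1 * q)%N <= (mu + e / 2) * ((c%:R + 1) * q%:R).
  have : (c.+1 * q)%:R^-1 * S (c.+1 * q)%N <= mu + e / 2
    by move: Hc1; set a := _ * S _; rewrite ler_norml => /andP[]; lra.
  by rewrite [X in X <= _ -> _]mulrC natE ler_pdivrMr.
set a := n%:R^-1 * S n.
have aE : a * n%:R = S n by rewrite /a mulrAC mulVf ?mul1r// gt_eqF.
suff /andP[h1 h2] : ((mu - e) * n%:R <= S n) && (S n <= (mu + e) * n%:R).
  move: h1 h2; rewrite -aE !ler_pM2r// ler_norml => h1 h2.
  by apply/andP; split; lra.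
clear a aE.
apply/andP; split.
  have [me|me] := leP (mu - e) 0.
    by apply: (le_trans _ (S0 n)); rewrite mulr_le0_ge0// ltW.
  apply: (le_trans _ S1); apply: (le_trans _ Sc).
  apply: (@le_trans _ _ ((mu - e) * ((c%:R + 1) * q%:R))); first by rewrite ler_pM2l.
  by rewrite !mulrA ler_pM2r//; lra.
apply: (le_trans S2); apply: (le_trans Sc1).
apply: (@le_trans _ _ ((mu + e) * (c%:R * q%:R))); last first.
  by rewrite ler_pM2l// ltr_wpDl.
by rewrite !mulrA ler_pM2r//; lra.
Qed.

Section strong_law.
Context d d' (T : measurableType d) (S : measurableType d') (R : realType)
  (P : probability T R) (X : nat -> {RV P >-> S}).
Hypothesis X_iid : iid X.

Lemma strong_law_ge0 (h : S -> R) : measurable_fun setT h -> (forall s, 0 <= h s) ->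
  P.-integrable setT (fun x => (h (X 0%N x))%:E) ->
  {ae P, forall x, n%:R^-1 * \sum_(i < n) h (X i x)
     @[n --> \oo] --> \int[P]_x h (X 0%N x)}.
Proof.
move=> mh h0 ih; have [Xind Xid] := X_iid.
have mZ i : measurable_fun setT (h \o X i) by exact: measurableT_comp.
pose Z i : {mfun T >-> R} := mfun_Sub (mem_set (mZ i)).
have indZ i j : i != j -> indep2 P (Z i) (Z j).
  move=> ij; apply: (@indep2_comp _ _ _ _ _ _ _ P _ _ R R (X i) (X j) h h) => //.
  exact: mutually_independent_pair.
have idZ i A : measurable A -> P (Z i @^-1` A) = P (Z 0%N @^-1` A).
  move=> mA; apply: (Xid i 0%N (h @^-1` A)).
  by rewrite -[X in measurable X]setTI; exact: mh.
have : {ae P, forall x, forall c, (0 < c)%N ->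
    (c * 2 ^ l)%:R^-1 * \sum_(i < c * 2 ^ l) Z i x @[l --> \oo] --> \int[P]_x Z 0%N x}.
  apply: ae_foralln => c; have [->|c0] := posnP c; first exact: aeW.
  have := @dyadic_strong_law _ _ _ P Z (fun i x => h0 _) indZ idZ ih c c0.
  by apply: filterS.
apply: filterS => x Hx.
apply: (@dyadic_interpolation R (fun n => \sum_(i < n) h (X i x))) => //.
- by move=> n; exact: sumr_ge0.
- move=> m n mn; rewrite -(subnKC mn) big_split_ord /= lerDl; exact: sumr_ge0.
Qed.

(** By positive and negative parts. The function [h] is kept general because coordinates and
    products of coordinates are both needed. *)
Lemma strong_law (h : S -> R) : measurable_fun setT h ->
  P.-integrable setT (fun x => (h (X 0%N x))%:E) ->
  {ae P, forall x, n%:R^-1 * \sum_(i < n) h (X i x)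
     @[n --> \oo] --> \int[P]_x h (X 0%N x)}.
Proof.
move=> mh ih.
pose hp s := Num.max (h s) 0; pose hn s := Num.max (- h s) 0.
have hE s : h s = hp s - hn s.
  by rewrite /hp /hn; case: (leP (h s) 0); case: (leP (- h s) 0); lra.
have mhp : measurable_fun setT hp by apply: (measurable_maxr (g := cst 0)).
have mhn : measurable_fun setT hn.
  by apply: (measurable_maxr (f := \- h) (g := cst 0)) => //; exact: measurableT_comp.
have ihp : P.-integrable setT (fun x => (hp (X 0%N x))%:E).
  apply: le_integrable ih => //.
    by apply/measurable_EFinP; exact: (measurableT_comp (f := hp)).
  by move=> x _ /=; rewrite lee_fin /hp; case: (leP (h (X 0%N x)) 0); rewrite ?normr0.
have ihn : P.-integrable setT (fun x => (hn (X 0%N x))%:E).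
  apply: le_integrable ih => //.
    by apply/measurable_EFinP; exact: (measurableT_comp (f := hn)).
  move=> x _ /=; rewrite lee_fin /hn; case: (leP (- h (X 0%N x)) 0); rewrite ?normr0//.
  by rewrite normrN.
have Hp := strong_law_ge0 mhp (fun s => ltac:(by rewrite le_max lexx orbT)) ihp.
have Hn := strong_law_ge0 mhn (fun s => ltac:(by rewrite le_max lexx orbT)) ihn.
apply: filterS2 Hp Hn => x Hp Hn.
rewrite (_ : (fun n => _) = (fun n => n%:R^-1 * (\sum_(i < n) hp (X i x)) -
    n%:R^-1 * (\sum_(i < n) hn (X i x)))); last first.
  by apply/funext => n; rewrite -mulrBr -sumrB; under eq_bigr do rewrite hE.
rewrite (_ : \int[P]_x _ = \int[P]_x hp (X 0%N x) - \int[P]_x hn (X 0%N x)).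
  exact: cvgB.
by rewrite -RintegralB//; apply: eq_Rintegral => y _; exact: hE.
Qed.

End strong_law.

(** * The bootstrap central limit theorem in one dimension *)

Section trigonometric_moments.
Context d (T : measurableType d) (R : realType) (P : probability T R).

(** Real and imaginary parts of the multiplicativity of characteristic functions. *)
Lemma indep2_expect_trigD (Y W : T -> R) :
  measurable_fun setT Y -> measurable_fun setT W -> indep2 P Y W ->
  \int[P]_x cos (Y x + W x) =
    \int[P]_x cos (Y x) * \int[P]_x cos (W x) -
    \int[P]_x sin (Y x) * \int[P]_x sin (W x) /\
  \int[P]_x sin (Y x + W x) =
    \int[P]_x sin (Y x) * \int[P]_x cos (W x) +
    \int[P]_x cos (Y x) * \int[P]_x sin (W x).
Proof.
move=> mY mW YW.
pose Y' : {mfun T >-> R} := mfun_Sub (mem_set mY).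
pose W' : {mfun T >-> R} := mfun_Sub (mem_set mW).
have bc : bmeas (fun x : R => cos x) by exact: bmeas_cos.
have bs : bmeas (fun x : R => sin x) by exact: bmeas_sin.
have E (f g : R -> R) : bmeas f -> bmeas g ->
    \int[P]_x (f (Y x) * g (W x)) = \int[P]_x f (Y x) * \int[P]_x g (W x).
  by move=> bf bg; exact: (@indep2_expectM _ _ _ _ _ _ _ P Y' W').
split.
- under eq_Rintegral => x _ do rewrite cosD.
  by rewrite expectB ?E//; apply: bmeasM;
    solve [exact: bmeas_cos|exact: bmeas_sin].
- under eq_Rintegral => x _ do rewrite sinD.
  by rewrite expectD ?E//; apply: bmeasM;
    solve [exact: bmeas_cos|exact: bmeas_sin].
Qed.

Context d' (S : measurableType d') (I : choiceType) (Y : I -> {mfun T >-> S}).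
Hypothesis indY : mutually_independent (P := P) Y.
Variable g : I -> S -> R.
Hypothesis mg : forall i, measurable_fun setT (g i).

Let mgY i : measurable_fun setT (fun x => g i (Y i x)).
Proof. by apply: (measurableT_comp (f := g i)). Qed.

Lemma expect_trig_cons k s : k \notin s ->
  \int[P]_x cos (\sum_(i <- k :: s) g i (Y i x)) =
    \int[P]_x cos (g k (Y k x)) * \int[P]_x cos (\sum_(i <- s) g i (Y i x)) -
    \int[P]_x sin (g k (Y k x)) * \int[P]_x sin (\sum_(i <- s) g i (Y i x)) /\
  \int[P]_x sin (\sum_(i <- k :: s) g i (Y i x)) =
    \int[P]_x sin (g k (Y k x)) * \int[P]_x cos (\sum_(i <- s) g i (Y i x)) +
    \int[P]_x cos (g k (Y k x)) * \int[P]_x sin (\sum_(i <- s) g i (Y i x)).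
Proof.
move=> ks.
under eq_Rintegral => x _ do rewrite big_cons.
under [X in _ /\ X = _]eq_Rintegral => x _ do rewrite big_cons.
apply: indep2_expect_trigD => //; first exact: measurable_sum.
have := mutually_independent_sum indY ks mg.
apply: (@indep2_comp _ _ _ _ _ _ _ P _ _ R R (Y k) _ (g k) idfun) => //. exact: measurable_id.
Qed.

Lemma expect_trig_gaussian (t : I -> R) (s : seq I) :
  (forall i, \int[P]_x cos (g i (Y i x)) = expR (- (t i ^+ 2 / 2))) ->
  (forall i, \int[P]_x sin (g i (Y i x)) = 0) -> uniq s ->
  \int[P]_x cos (\sum_(i <- s) g i (Y i x)) =
    expR (- ((\sum_(i <- s) t i ^+ 2) / 2)) /\
  \int[P]_x sin (\sum_(i <- s) g i (Y i x)) = 0.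
Proof.
move=> gc gs; elim: s => [_|k s IH /= /andP[ks us]].
  under eq_Rintegral => x _ do rewrite big_nil cos0.
  under [X in _ /\ X = _]eq_Rintegral => x _ do rewrite big_nil sin0.
  by rewrite !expect_cst big_nil mul0r oppr0 expR0.
have [IHc IHs] := IH us.
have [-> ->] := expect_trig_cons ks.
rewrite gc gs IHc IHs !mul0r mulr0 subr0 addr0 big_cons -expRD; split=> //.
by congr expR; ring.
Qed.

(** The real form of |z^n - c^n| <= n |z - c| for moduli at most 1, with z = C + i S'. The factor 2
    comes from adding the errors of real and imaginary parts. *)
Lemma expect_cos_approx (C S' c : R) (s : seq I) :
  (forall i, \int[P]_x cos (g i (Y i x)) = C) ->
  (forall i, \int[P]_x sin (g i (Y i x)) = S') -> 0 <= c <= 1 -> uniq s ->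
  `|\int[P]_x cos (\sum_(i <- s) g i (Y i x)) - c ^+ size s| +
  `|\int[P]_x sin (\sum_(i <- s) g i (Y i x))| <=
  2 * (size s)%:R * (`|C - c| + `|S'|).
Proof.
move=> gc gs /andP[c0 c1]; elim: s => [_|k s IH /= /andP[ks us]].
  under eq_Rintegral => x _ do rewrite big_nil cos0.
  under [X in _ + `|X|]eq_Rintegral => x _ do rewrite big_nil sin0.
  by rewrite !expect_cst expr0 subrr normr0 addr0 mulr0 mul0r.
have {IH us} := IH us.
have [-> ->] := expect_trig_cons ks; rewrite gc gs.
set p := \int[P]_x cos _; set q := \int[P]_x sin _ => IH.
have ms : measurable_fun setT (fun x => \sum_(i <- s) g i (Y i x)).
  exact: measurable_sum.
have p1 : `|p| <= 1.
  apply: expect_norm_le; first exact: bmeas_cos.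
  by move=> x; rewrite ler_norml cos_geN1 cos_le1.
have q1 : `|q| <= 1.
  apply: expect_norm_le; first exact: bmeas_sin.
  by move=> x; rewrite ler_norml sin_geN1 sin_le1.
(* The previous error is multiplied by [c], which does not enlarge it; every other term carries
   [C - c] or [S'] times an expectation bounded by 1. *)
have -> : C * p - S' * q - c ^+ (size s).+1 =
    c * (p - c ^+ size s) + (C - c) * p - S' * q by rewrite exprS; ring.
have -> : S' * p + C * q = c * q + (C - c) * q + S' * p by ring.
have -> : 2 * (size s).+1%:R * (`|C - c| + `|S'|) =
  2 * (size s)%:R * (`|C - c| + `|S'|) + 2 * (`|C - c| + `|S'|).
  by rewrite -natr1; ring.
set e := p - _ in IH *.
have h1 : `|c * e + (C - c) * p - S' * q| <= `|e| + `|C - c| + `|S'|.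
  rewrite (le_trans (ler_normB _ _))// lerD//.
    rewrite (le_trans (ler_normD _ _))// lerD// normrM.
      by rewrite ger0_norm// ler_piMl.
    by rewrite ler_piMr.
  by rewrite normrM ler_piMr.
have h2 : `|c * q + (C - c) * q + S' * p| <= `|q| + `|C - c| + `|S'|.
  rewrite (le_trans (ler_normD _ _))// lerD//.
    rewrite (le_trans (ler_normD _ _))// lerD// normrM.
      by rewrite ger0_norm// ler_piMl.
    by rewrite ler_piMr.
  by rewrite normrM ler_piMr.
by lra.
Qed.

End trigonometric_moments.

(** * Taylor bounds for cosine, sine and exponential *)

Section trigonometric_taylor.
Variable R : realType.
Implicit Types (x : R) (f : R -> R).

(** Mean value theorem. It is climbed as a ladder: in each of the following inequalities the
    derivative is nonnegative by the preceding one, starting from cos <= 1. *)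
Lemma ge0_derive_ge0 f (df : R -> R) x :
  (forall y, is_derive y (1 : R) f (df y)) -> (forall y, 0 <= y -> 0 <= df y) ->
  f 0 = 0 -> 0 <= x -> 0 <= f x.
Proof.
move=> fdf df0 f0 x0.
have [|y /andP[y0 _] E] := @MVT_segment _ f df 0 x x0 (fun y _ => fdf y).
  by apply: continuous_subspaceT => y; apply/differentiable_continuous/derivable1_diffP; case: (fdf y).
rewrite -[f x]subr0 -[X in _ - X]f0 E mulr_ge0 ?subr_ge0//.
by rewrite df0.
Qed.

Let dX n (c : R) (y : R) : is_derive y (1 : R) (fun z => z ^+ n.+1 / c) (n.+1%:R / c * y ^+ n).
Proof.
rewrite (_ : (fun z => _) = c^-1 \*: ((@id R) ^+ n.+1)); last first.
  by apply/funext => z; rewrite !fctE /GRing.scale/= mulrC.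
by apply: is_derive_eq; rewrite /GRing.scale /=; ring.
Qed.

Let dB (f g : R -> R) (y df dg : R) : is_derive y (1 : R) f df ->
  is_derive y (1 : R) g dg -> is_derive y (1 : R) (fun z => f z - g z) (df - dg).
Proof. by move=> ? ?; exact: is_deriveB. Qed.

Let dD (f g : R -> R) (y df dg : R) : is_derive y (1 : R) f df ->
  is_derive y (1 : R) g dg -> is_derive y (1 : R) (fun z => f z + g z) (df + dg).
Proof. by move=> ? ?; exact: is_deriveD. Qed.

Let did (y : R) : is_derive y (1 : R) (fun z => z) 1.
Proof. exact: is_derive_id. Qed.

Let dc (c y : R) : is_derive y (1 : R) (fun=> c) 0.
Proof. exact: is_derive_cst. Qed.

Let sin_le x : 0 <= x -> 0 <= x - sin x.
Proof.
apply: (@ge0_derive_ge0 (fun x => x - sin x) (fun y => 1 - cos y)); last by rewrite /= sin0 subr0.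
- by move=> y _; rewrite subr_ge0 cos_le1.
Qed.

Let cos_ge x : 0 <= x -> 0 <= x ^+ 2 / 2 + cos x - 1.
Proof.
apply: (@ge0_derive_ge0 (fun x => x ^+ 2 / 2 + cos x - 1) (fun y => y - sin y)); last by rewrite /= cos0 expr0n/= mul0r add0r subrr.
- move=> y; have h := dB (dD (dX 1 2 y) (is_derive_cos y)) (dc 1 y).
  apply: trigger_derive h _.
  by rewrite subr0; field.
- exact: sin_le.
Qed.

Let sin_ge x : 0 <= x -> 0 <= x ^+ 3 / 6 + sin x - x.
Proof.
apply: (@ge0_derive_ge0 (fun x => x ^+ 3 / 6 + sin x - x) (fun y => y ^+ 2 / 2 + cos y - 1)); last by rewrite /= sin0 expr0n/= mul0r add0r subrr.
- move=> y; have h := dB (dD (dX 2 6 y) (is_derive_sin y)) (did y).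
  apply: trigger_derive h _.
  by field.
- exact: cos_ge.
Qed.

Let cos_le x : 0 <= x -> 0 <= x ^+ 4 / 24 - (x ^+ 2 / 2 + cos x - 1).
Proof.
apply: (@ge0_derive_ge0 (fun x => x ^+ 4 / 24 - (x ^+ 2 / 2 + cos x - 1)) (fun y => y ^+ 3 / 6 + sin y - y)); last by rewrite /= cos0; field.
- move=> y; have h := dB (dX 3 24 y) (dB (dD (dX 1 2 y) (is_derive_cos y)) (dc 1 y)).
  apply: trigger_derive h _.
  by field.
- exact: sin_ge.
Qed.

Lemma cos_taylor x : `|cos x - 1 + x ^+ 2 / 2| <= x ^+ 4 / 24.
Proof.
wlog x0 : x / 0 <= x => [H|].
  have [/H//|/ltW x0] := leP 0 x; have := H (- x); rewrite cosN sqrrN (exprNn x 4).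
  by rewrite -[(-1) ^+ 4]signr_odd /= mul1r; apply; rewrite oppr_ge0.
have := cos_ge x0; have := cos_le x0 => h1 h2.
by rewrite ger0_norm; lra.
Qed.

Lemma sin_taylor x : `|sin x - x| <= `|x| ^+ 3 / 6.
Proof.
wlog x0 : x / 0 <= x => [H|].
  have [/H//|/ltW x0] := leP 0 x; have := H (- x); rewrite sinN normrN -opprD normrN.
  by apply; rewrite oppr_ge0.
have := sin_ge x0; have := sin_le x0 => h1 h2.
by rewrite (ger0_norm x0) ler0_norm; lra.
Qed.

(** Both bounds come from exp y >= 1 + y, used at - x directly and at x after inversion. *)
Lemma expRN_taylor x : 0 <= x -> `|expR (- x) - 1 + x| <= x ^+ 2.
Proof.
move=> x0; have h1 := expR_ge1Dx (- x); rewrite ger0_norm; last by lra.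
have x1 : 0 < 1 + x by lra.
have : expR (- x) <= (1 + x)^-1.
  by rewrite expRN lef_pV2 ?posrE ?expR_gt0// expR_ge1Dx.
have : (1 + x)^-1 <= 1 - x + x ^+ 2.
  rewrite -[leLHS]mul1r ler_pdivrMr// -subr_ge0.
  have -> : (1 - x + x ^+ 2) * (1 + x) - 1 = x ^+ 3 by ring.
  exact: exprn_ge0.
lra.
Qed.

End trigonometric_taylor.

Section uniform_index.
Context d (T : measurableType d) (R : realType) (P : probability T R).
Variables (n : nat) (K : {RV P >-> nat}).
Hypothesis n_gt0 : (0 < n)%N.
Hypothesis K_unif : uniform_below n K.

(** Only probabilities of singletons are given, so the event that [K] leaves the range has to be
    shown null; off this event f(K) is a finite combination of indicators. *)
Lemma uniform_below_expect (f : nat -> R) : (exists M, forall m, `|f m| <= M) ->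
  \int[P]_x f (K x) = n%:R^-1 * \sum_(i < n) f i.
Proof.
move=> [M fM].
have M0 : 0 <= M by rewrite (le_trans _ (fM 0%N)).
have mK (A : set nat) : measurable (K @^-1` A) by exact: measurable_funPTI.
have PK (i : nat) : (i < n)%N -> \int[P]_x (\1_(K @^-1` [set i]) x : R) = n%:R^-1.
  move=> ni; apply: EFin_inj; rewrite expect_indic//.
  by have := K_unif i; rewrite ni.
pose B : set T := K @^-1` [set m | (n <= m)%N].
have bi (i : 'I_n) : bmeas (fun x => \1_(K @^-1` [set (i : nat)]) x : R).
  exact: bmeas_indic.
have [bS ES] := expect_sum P (index_enum 'I_n) bi.
have bB : bmeas (fun x => \1_B x : R) by apply: bmeas_indic; exact: mK.
(* The right-hand side has expectation 1 - n / n = 0, so [B] is null. *)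
have part x : \1_B x = 1 - \sum_(i < n) \1_(K @^-1` [set (i : nat)]) x :> R.
  have [nK|Kn] := leqP n (K x).
    rewrite big1 ?subr0; first by rewrite indicE mem_set.
    move=> i _; rewrite indicE memNset//= => Ki.
    by move: nK; rewrite Ki leqNgt ltn_ord.
  rewrite (bigD1 (Ordinal Kn))//= big1 ?addr0.
    have nB : ~ B x by rewrite /B /= leqNgt Kn.
    by rewrite !indicE [in RHS]mem_set//= subrr (memNset nB).
  by move=> i iK; rewrite indicE memNset//= => Ki; move: iK; rewrite -val_eqE/= Ki eqxx.
have EB : \int[P]_x (\1_B x : R) = 0.
  under eq_Rintegral => x _ do rewrite part.
  rewrite expectB//; last exact: bmeas_cst.
  rewrite expect_cst ES; under eq_bigr => i _ do rewrite PK//.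
  by rewrite sumr_const card_ord -[_ *+ n]mulr_natl mulfV ?subrr// pnatr_eq0 -lt0n.
have bf : bmeas (fun x => f (K x)).
  by split; [exact: (measurableT_comp (f := f))|exists M => x; exact: fM].
have bfi (i : 'I_n) : bmeas (fun x => f i * \1_(K @^-1` [set (i : nat)]) x).
  by apply: bmeasM => //; exact: bmeas_cst.
have [bfS EfS] := expect_sum P (index_enum 'I_n) bfi.
have -> : n%:R^-1 * \sum_(i < n) f i =
    \int[P]_x (\sum_(i < n) f i * \1_(K @^-1` [set (i : nat)]) x).
  rewrite EfS mulr_sumr; apply: eq_bigr => i _.
  by rewrite expectZ// PK// mulrC.
apply/eqP; rewrite -subr_eq0 -expectB// -normr_le0.
apply: (@le_trans _ _ (\int[P]_x (M * \1_B x))); last by rewrite expectZ// EB mulr0.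
apply: le_trans (le_normr_Rintegral _ _) _ => //.
  by apply: bmeas_integrable; exact: bmeasB.
apply: expect_le.
- have [m1 [C hC]] := bmeasB bf bfS; split; first exact: measurableT_comp.
  by exists C => x; rewrite normr_id.
- by apply: bmeasM => //; exact: bmeas_cst.
move=> x; have [nK|Kn] := leqP n (K x).
  rewrite big1 ?subr0; first by rewrite indicE mem_set// mulr1.
  move=> i _; rewrite indicE memNset ?mulr0//= => Ki.
  by move: nK; rewrite Ki leqNgt ltn_ord.
rewrite (bigD1 (Ordinal Kn))//= big1 ?addr0.
  by rewrite indicE mem_set//= mulr1 subrr normr0 mulr_ge0.
by move=> i iK; rewrite indicE memNset ?mulr0//= => Ki; move: iK; rewrite -val_eqE/= Ki eqxx.
Qed.

End uniform_index.

(** * The centered array of a real sequence *)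

Section studentized_array.
Variables (R : realType) (a : nat -> R) (s2 : R).
Let mean (n : nat) : R := n%:R^-1 * \sum_(i < n) a i.
Let msq (n : nat) : R := n%:R^-1 * \sum_(i < n) a i ^+ 2.
Hypothesis mean0 : mean n @[n --> \oo] --> 0.
Hypothesis msq_cvg : msq n @[n --> \oo] --> s2.

(** The factor sqrt n and the 1 / n of the mean combine into 1 / sqrt n: a sum of n draws of this
    quantity is sqrt n times the bootstrap mean of [a]. *)
Definition centered_scaled (n i : nat) : R := (a i - mean n) / Num.sqrt n%:R.
Let b := centered_scaled.

Lemma msq_limit_ge0 : 0 <= s2.
Proof.
apply: (cvgr_to_ge msq_cvg); apply: nearW => n.
by rewrite mulr_ge0 ?invr_ge0// sumr_ge0// => i _; exact: sqr_ge0.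
Qed.

Let sum_b n : \sum_(i < n) b n i = 0.
Proof.
case: n => [|n]; first by rewrite big_ord0.
rewrite -mulr_suml sumrB sumr_const card_ord -[_ *+ n.+1]mulr_natl /mean mulrA.
by rewrite mulfV ?mul1r ?subrr ?mul0r// pnatr_eq0.
Qed.

Let sum_b2 n : (0 < n)%N -> \sum_(i < n) b n i ^+ 2 = msq n - mean n ^+ 2.
Proof.
move=> n0; have nR : n%:R != 0 :> R by rewrite pnatr_eq0 -lt0n.
under eq_bigr => i _ do rewrite /b /centered_scaled expr_div_n sqr_sqrtr ?ler0n//.
rewrite -mulr_suml.
under eq_bigr => i _ do rewrite sqrrB.
rewrite big_split/= sumrB sumr_const card_ord -[_ *+ n]mulr_natl.
under [X in _ - X]eq_bigr => i _ do rewrite -mulrnAl -[_ *+ 2]mulr_natl.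
rewrite -mulr_suml -mulr_sumr.
have -> : \sum_(i < n) a i = n%:R * mean n by rewrite /mean mulrA mulfV// mul1r.
have -> : \sum_(i < n) a i ^+ 2 = n%:R * msq n by rewrite /msq mulrA mulfV// mul1r.
by field.
Qed.

Let cvg_q : \sum_(i < n) b n i ^+ 2 @[n --> \oo] --> s2.
Proof.
have h : msq n - mean n ^+ 2 @[n --> \oo] --> s2.
  rewrite -[s2]subr0; apply: cvgB => //.
  by rewrite -[X in _ --> X](mulr0 0); apply: cvgM.
apply: cvg_trans h; apply: near_eq_cvg; near=> n.
by rewrite sum_b2//; near: n; exact: nbhs_infty_gt.
Unshelve. all: by end_near. Qed.

(** Uniform negligibility, in place of a Lindeberg condition. The identity a_n^2 / (n + 1) = msq (n
    + 1) - (n / (n + 1)) msq n shows that the left side tends to 0. Indices below some N contribute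
    a constant over n; the others satisfy a_i^2 <= de^2 (i + 1) <= de^2 n. *)
Let b_small (e : R) : 0 < e ->
  \forall n \near \oo, forall i, (i < n)%N -> `|b n i| <= e.
Proof.
move=> e0; pose de := e / 2; have de0 : 0 < de by rewrite divr_gt0.
have cv : a n ^+ 2 / n.+1%:R @[n --> \oo] --> 0.
  have -> : (fun n => a n ^+ 2 / n.+1%:R) = (fun n => msq n.+1 - (1 - n.+1%:R^-1) * msq n).
    apply/funext => n; rewrite /msq big_ord_recr /=.
    have -> : (1 - n.+1%:R^-1) = n.+1%:R^-1 * n%:R :> R.
      by rewrite -natr1; field; rewrite ?natr1 ?nat1r pnatr_eq0.
    case: n => [|n]; first by rewrite !big_ord0 add0r !mulr0 subr0 mulrC.
    rewrite -[_ * n.+1%:R * _]mulrA mulVKf ?pnatr_eq0// -mulrBr addrAC subrr add0r.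
    by rewrite mulrC.
  rewrite -[X in _ --> X](subrr s2); apply: cvgB.
    by rewrite cvg_shiftS.
  rewrite -[X in _ --> X]mul1r; apply: cvgM => //.
  by rewrite -[X in _ --> X]subr0; apply: cvgB; [exact: cvg_cst|exact: cvg_harmonic].
have /cvgr0Pnorm_le/(_ (de ^+ 2)) [|N _ HN] := cv; first by rewrite exprn_gt0.
have /cvgr0Pnorm_le/(_ de de0) Hmean := mean0.
pose C := \sum_(i < N) a i ^+ 2.
near=> n => i ni.
have n0 : (0 < n)%N by exact: leq_ltn_trans ni.
have sq0 : 0 < Num.sqrt n%:R :> R by rewrite sqrtr_gt0 ltr0n.
have ai2 : a i ^+ 2 <= de ^+ 2 * n%:R.
  have [Ni|iN] := leqP N i.
    have := HN i Ni; rewrite ger0_norm ?divr_ge0 ?sqr_ge0// ler_pdivrMr// => /le_trans; apply.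
    by rewrite ler_pM2l ?exprn_gt0// ler_nat.
  have aC : a i ^+ 2 <= C.
    by rewrite /C (bigD1 (Ordinal iN))//= lerDl sumr_ge0// => j _; exact: sqr_ge0.
  apply: (le_trans aC); rewrite mulrC -ler_pdivrMr ?exprn_gt0//.
  by near: n; exact: nbhs_infty_ger.
have ai : `|a i| <= de * Num.sqrt n%:R.
  have X0 : 0 <= de * Num.sqrt n%:R by apply: mulr_ge0; [exact: ltW|].
  rewrite -(@ler_pXn2r _ 2) ?nnegrE//.
  by rewrite real_normK ?num_real// exprMn sqr_sqrtr ?ler0n.
have mn : `|mean n| <= de * Num.sqrt n%:R.
  apply: (@le_trans _ _ de); first by near: n.
  by rewrite ler_peMr ?(ltW de0)// -[leLHS]sqrtr1 ler_sqrt ?ler1n// ltr0n.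
rewrite /b /centered_scaled normf_div (ger0_norm (ltW sq0)) ler_pdivrMr//.
rewrite (le_trans (ler_normB _ _))//.
have -> : e = de + de by rewrite /de; field.
by rewrite mulrDl lerD.
Unshelve. all: by end_near. Qed.

(** [C] and [S] are the real and imaginary parts, at 1, of the characteristic function of one draw;
    [c n] is the n-th root of the limit exp (- s2 / 2). *)
Let C n := n%:R^-1 * \sum_(i < n) cos (b n i).
Let S n := n%:R^-1 * \sum_(i < n) sin (b n i).
Let c n : R := expR (- (s2 / (2 * n%:R))).

(** Centering removes the linear term of the sine, and the quadratic term of the cosine is half the
    sum of squares. The remainders of order 3 and 4 are at most [e] times this sum because every
    entry is bounded by [e]. *)
Let phase_bound (n : nat) (e : R) : (0 < n)%N -> 0 < e <= 1 ->
  (forall i, (i < n)%N -> `|b n i| <= e) ->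
  n%:R * (`|C n - c n| + `|S n|) <=
    e * \sum_(i < n) b n i ^+ 2 + `|\sum_(i < n) b n i ^+ 2 - s2| + s2 ^+ 2 * n%:R^-1.
Proof.
move=> n0 /andP[e0 e1] be; have nR : 0 < n%:R :> R by rewrite ltr0n.
have nR0 : n%:R != 0 :> R by rewrite gt_eqF.
set q := \sum_(i < n) _.
have q0 : 0 <= q by rewrite sumr_ge0// => i _; exact: sqr_ge0.
have hS : n%:R * `|S n| <= e * q / 6.
  rewrite -[n%:R in leLHS]ger0_norm// -normrM /S mulrA mulfV// mul1r.
  have -> : \sum_(i < n) sin (b n i) = \sum_(i < n) (sin (b n i) - b n i).
    by rewrite sumrB sum_b subr0.
  rewrite (le_trans (ler_norm_sum _ _ _))// mulr_sumr mulr_suml ler_sum// => i _.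
  rewrite (le_trans (sin_taylor _))// ler_pM2r// -[in leRHS](real_normK (num_real (b n i))) exprS.
  by rewrite ler_wpM2r ?exprn_ge0// be.
have hc : n%:R * `|c n - 1 + s2 / (2 * n%:R)| <= s2 ^+ 2 * n%:R^-1.
  have x0 : 0 <= s2 / (2 * n%:R) by rewrite divr_ge0 ?msq_limit_ge0 ?mulr_ge0.
  apply: (@le_trans _ _ (n%:R * (s2 / (2 * n%:R)) ^+ 2)).
    by rewrite ler_pM2l// expRN_taylor.
  have -> : n%:R * (s2 / (2 * n%:R)) ^+ 2 = (s2 ^+ 2 * n%:R^-1) / 4 by field.
  have : 0 <= s2 ^+ 2 * n%:R^-1 by rewrite mulr_ge0 ?sqr_ge0 ?invr_ge0.
  by lra.
have hC : `|\sum_(i < n) (cos (b n i) - 1 + b n i ^+ 2 / 2)| <= e * q / 24.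
  rewrite (le_trans (ler_norm_sum _ _ _))// mulr_sumr mulr_suml ler_sum// => i _.
  rewrite (le_trans (cos_taylor _))// ler_pM2r// (exprD _ 2 2).
  rewrite ler_wpM2r ?sqr_ge0// -real_normK ?num_real// expr2.
  rewrite -[leRHS]mulr1 ler_pM// ?be// (le_trans (be _ _))//.
(* Exact splitting into the cosine remainder, the discrepancy between [q] and [s2], and the
   remainder of the exponential. *)
have CE : n%:R * (C n - c n) = \sum_(i < n) (cos (b n i) - 1 + b n i ^+ 2 / 2)
    - (q - s2) / 2 - n%:R * (c n - 1 + s2 / (2 * n%:R)).
  rewrite big_split/= sumrB sumr_const card_ord -mulr_suml -/q /C.
  by rewrite mulrBr mulrA mulfV// mul1r; field.
have hCc : n%:R * `|C n - c n| <= e * q / 24 + `|q - s2| + s2 ^+ 2 * n%:R^-1.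
  rewrite -[n%:R in leLHS]ger0_norm// -normrM CE.
  rewrite (le_trans (ler_normB _ _))// lerD//; last by rewrite normrM ger0_norm.
  rewrite (le_trans (ler_normB _ _))// lerD// normrM.
  by have := normr_ge0 (q - s2); rewrite [X in _ * X]ger0_norm//; lra.
have eq0 : 0 <= e * q by rewrite mulr_ge0// ltW.
by rewrite mulrDr; lra.
Qed.

Lemma cvg_phase : n%:R * (`|C n - c n| + `|S n|) @[n --> \oo] --> 0.
Proof.
apply/cvgr0Pnorm_le => e e0; have s20 := msq_limit_ge0.
(* The sum of squares is eventually at most s2 + 1, so this choice keeps the first error term below
   e / 3. *)
pose de := Num.min 1 (e / (3 * (s2 + 1))).
have s1 : 0 < 3 * (s2 + 1) by rewrite mulr_gt0// ltr_wpDl.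
have de0 : 0 < de by rewrite /de lt_min ltr01 divr_gt0.
have e3 : 0 < e / 3 by rewrite divr_gt0.
have q1 : \forall n \near \oo, `|\sum_(i < n) b n i ^+ 2 - s2| <= Num.min 1 (e / 3).
  move: cvg_q => /cvgrPdistC_le; apply; by rewrite lt_min ltr01.
have n1 : \forall n \near \oo, s2 ^+ 2 * n%:R^-1 <= e / 3.
  near=> n; rewrite ler_pdivrMr; last by rewrite ltr0n; near: n; exact: nbhs_infty_gt.
  by rewrite mulrC -ler_pdivrMr//; near: n; exact: nbhs_infty_ger.
near=> n.
have n0 : (0 < n)%N by near: n; exact: nbhs_infty_gt.
rewrite ger0_norm ?mulr_ge0 ?addr_ge0//.
apply: le_trans (phase_bound n0 (_ : 0 < de <= 1) _) _.
- by rewrite de0 ge_min lexx.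
- by near: n; exact: b_small.
have : `|\sum_(i < n) b n i ^+ 2 - s2| <= Num.min 1 (e / 3) by near: n.
rewrite le_min => /andP[h1 h2].
have h3 : s2 ^+ 2 * n%:R^-1 <= e / 3 by near: n.
have h4 : de * \sum_(i < n) b n i ^+ 2 <= e / 3.
  apply: (@le_trans _ _ (de * (s2 + 1))).
    by rewrite ler_pM2l//; move: h1; rewrite ler_norml => /andP[_]; rewrite lerBlDl.
  rewrite -ler_pdivlMr; last by lra.
  rewrite /de ge_min; apply/orP; right.
  by rewrite invfM mulrA.
lra.
Unshelve. all: by end_near. Qed.

End studentized_array.

(** * Spectral theorem for real symmetric matrices *)

Section real_spectral_theorem.
Variable R : rcfType.

Lemma sqnorm_gt0 n (v : 'rV[R]_n) : v != 0 -> 0 < (v *m v^T) 0 0.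
Proof.
move=> v0; rewrite mxE lt_neqAle; apply/andP; split; last first.
  by apply: sumr_ge0 => i _; rewrite mxE -expr2 sqr_ge0.
rewrite eq_sym; apply: contra v0 => /eqP v0; apply/eqP/rowP => j; rewrite mxE.
move: v0 => /eqP; rewrite psumr_eq0; last by move=> i _; rewrite mxE -expr2 sqr_ge0.
by move=> /allP/(_ j); rewrite mem_index_enum mxE mulf_eq0 orbb => /(_ isT)/eqP.
Qed.

(** The reflection along w = u - e exchanges the first basis vector e and the unit vector [u]; if u
    = e, where w vanishes, the identity matrix serves. *)
Lemma householder n (u : 'rV[R]_(1 + n)) : u *m u^T = 1%:M ->
  exists H : 'M[R]_(1 + n), [/\ H^T = H, H *m H = 1%:M & delta_mx 0 0 *m H = u].
Proof.
move=> u1; pose e : 'rV[R]_(1 + n) := delta_mx 0 0.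
have e1 : e *m e^T = 1%:M.
  by rewrite trmx_delta mul_delta_mx; apply/matrixP => i j; rewrite !ord1 !mxE.
have [eu|eu] := eqVneq u e.
  by exists 1%:M; rewrite trmx1 !mulmx1 eu.
have [w wE] : exists w, w = u - e by exists (u - e).
have w0 : w != 0 by rewrite wE subr_eq0.
pose b := (w *m w^T) 0 0.
have b0 : b != 0 by rewrite gt_eqF// sqnorm_gt0.
have bE : w *m w^T = b%:M by apply/matrixP => i j; rewrite !ord1 [RHS]mxE eqxx mulr1n.
exists (1%:M - (2 / b) *: (w^T *m w)); split.
- by rewrite linearB linearZ /= trmx1 trmx_mul trmxK.
- rewrite mulmxBl mul1mx mulmxBr mulmx1 -scalemxAl -scalemxAr mulmxA.
  rewrite -(mulmxA w^T) bE mul_mx_scalar -scalemxAl !scalerA.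
  have -> : 2 / b * (2 / b * b) = 2 * (2 / b) by field.
  by apply/matrixP => i j; rewrite !mxE; ring.
- rewrite mulmxBr mulmx1 -scalemxAr mulmxA.
  (* Since b = |u - e|^2 = 2 - 2 <e, u>, the product <e, w> = <e, u> - 1 equals - b / 2. *)
  have ew : e *m w^T = (- (b / 2))%:M.
    have ue : u *m e^T = e *m u^T.
      by rewrite -[LHS]trmxK trmx_mul trmxK; apply/matrixP => i j; rewrite !ord1 mxE.
    have : b%:M = (2 : R)%:M - (2 : R) *: (e *m u^T).
      rewrite -bE wE linearB /= mulmxBl !mulmxBr u1 e1 ue.
      move: (e *m u^T) => M; apply/matrixP => i j.
      by rewrite !ord1 !mxE eqxx !mulr1n; ring.
    move=> bE'; rewrite wE linearB /= mulmxBr e1.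
    move: (e *m u^T) bE' => M bE'; apply/matrixP => i j.
    move: bE' => /matrixP/(_ i j); rewrite !ord1 !mxE !eqxx !mulr1n => ->.
    by field.
  rewrite ew mul_scalar_mx scalerA.
  have -> : 2 / b * - (b / 2) = -1 by field.
  by rewrite scaleN1r opprK wE addrC subrK.
Qed.

(** Deflation: conjugation by a reflection makes the first basis vector an eigenvector for the first
    listed value, symmetry clears the rest of its row and column, and cancelling one factor of the
    characteristic polynomial leaves the other values, in their given order, to the smaller
    block. *)
Lemma real_spectral n (A : 'M[R]_n) (lambda : 'I_n -> R) : A^T = A ->
  char_poly A = \prod_(i < n) ('X - (lambda i)%:P) ->
  exists Q : 'M[R]_n, Q *m Q^T = 1%:M /\
    Q *m A *m Q^T = diag_mx (\row_i lambda i).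
Proof.
elim: n A lambda => [|n IH] A lambda symA charA.
  by exists 1%:M; split; apply/matrixP => -[].
have : eigenvalue A (lambda ord0).
  rewrite eigenvalue_root_char charA big_ord_recl rootM root_XsubC eqxx//.
move=> /eigenvalueP[v vA v0].
pose s := Num.sqrt ((v *m v^T) 0 0).
have s0 : s != 0 by rewrite gt_eqF// sqrtr_gt0 sqnorm_gt0.
pose u : 'rV[R]_(1 + n) := s^-1 *: v.
have u1 : u *m u^T = 1%:M.
  rewrite /u linearZ /= -scalemxAl -scalemxAr scalerA.
  apply/matrixP => i j; rewrite !ord1 mxE -[(v *m v^T) 0 0](@sqr_sqrtr R); last first.
    exact/ltW/sqnorm_gt0.
  by rewrite -/s !mxE eqxx mulr1n; field.
have uA : u *m (A : 'M[R]_(1 + n)) = lambda ord0 *: u.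
  by rewrite /u -scalemxAl vA !scalerA mulrC.
have [H [symH HH eH]] := householder u1.
have [B Bdef] : exists B : 'M[R]_(1 + n), B = H *m A *m H by exists (H *m A *m H).
have symB : B^T = B by rewrite Bdef !trmx_mul symH symA mulmxA.
have eB : delta_mx 0 0 *m B = lambda ord0 *: (delta_mx 0 0 : 'rV[R]_(1 + n)).
  by rewrite Bdef !mulmxA eH uA -scalemxAl -eH -mulmxA HH mulmx1.
have B0 j : B 0 j = lambda ord0 * (j == 0)%:R.
  have := congr1 (fun M : 'rV[R]_(1 + n) => M 0 j) eB.
  by rewrite -rowE !mxE eqxx.
pose B' := drsubmx B.
have BE : B = block_mx (lambda ord0)%:M 0 0 B'.
  rewrite -[LHS]submxK; congr block_mx; apply/matrixP => i j.
  - by rewrite !ord1 !mxE lshift0 B0 eqxx mulr1.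
  - by rewrite [i]ord1 !mxE lshift0 B0 mulr0.
  - by rewrite [j]ord1 !mxE lshift0 -symB mxE B0 mulr0.
have symB' : B'^T = B' by rewrite /B' trmx_drsub symB.
have charB : char_poly B = char_poly A.
  rewrite /char_poly.
  (* [H] is its own inverse, so [B] is similar to [A], already at the level of matrices with
     polynomial entries. *)
  have -> : char_poly_mx B = map_mx polyC H *m char_poly_mx A *m map_mx polyC H.
    rewrite /char_poly_mx mulmxBr mulmxBl Bdef !map_mxM; congr (_ - _).
    by rewrite scalar_mxC -mulmxA -map_mxM HH map_mx1 mulmx1.
  by rewrite !det_mulmx mulrAC -det_mulmx -map_mxM HH map_mx1 det1 mul1r.
have charB' : char_poly B' = \prod_(i < n) ('X - (lambda (lift ord0 i))%:P).
  have : char_poly B = ('X - (lambda ord0)%:P) * char_poly B'.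
    have <- : char_poly ((lambda ord0)%:M : 'M[R]_1) = 'X - (lambda ord0)%:P.
      by rewrite /char_poly det_mx11 !mxE.
    by rewrite BE /char_poly char_block_diag_mx det_ublock.
  rewrite charB charA big_ord_recl => /mulfI -> //.
  by rewrite polyXsubC_eq0.
have [Q' [Q1 QB]] := IH _ _ symB' charB'.
pose Q0 : 'M[R]_(1 + n) := block_mx 1%:M 0 0 Q'.
have trQ0 : Q0^T = block_mx 1%:M 0 0 Q'^T.
  by rewrite /Q0 (tr_block_mx 1%:M) !trmx0 trmx1.
suff [Q QQ] : exists Q : 'M[R]_(1 + n), Q *m Q^T = 1%:M /\
    Q *m (A : 'M[R]_(1 + n)) *m Q^T = diag_mx (\row_i lambda i) by exists Q.
exists (Q0 *m H); split.
  rewrite trmx_mul symH mulmxA -(mulmxA Q0) HH mulmx1 trQ0 /Q0.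
  by rewrite mulmx_block !mulmx0 !mul0mx !addr0 !add0r mulmx1 Q1 -scalar_mx_block.
rewrite trmx_mul symH mulmxA -!(mulmxA Q0) -Bdef.
rewrite trQ0 BE /Q0 !mulmx_block !mulmx0 !mul0mx !addr0 !add0r.
rewrite mulmx1 mul1mx mulmxA QB.
apply/matrixP => i j; case: (split_ordP i) => i' ->; case: (split_ordP j) => j' ->.
- by rewrite block_mxEul !ord1 !mxE lshift0.
- by rewrite block_mxEur mulmx0 [i']ord1 !mxE lshift0.
- by rewrite block_mxEdl mulmx0 [j']ord1 !mxE lshift0.
- rewrite block_mxEdr !mxE (inj_eq (@rshift_inj 1 n)); congr (_ *+ _).
  by congr lambda; apply/val_inj; rewrite /= /bump leq0n.
Qed.

End real_spectral_theorem.

(** * Characteristic function of the normal law *)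

Section normal_density_integral.
Variable R : realType.
Notation mu := (@lebesgue_measure R).

(** The Radon-Nikodym derivative of the normal law and [normal_pdf] have the same integral over
    every measurable set, hence agree almost everywhere. *)
Lemma integral_normal_prob (m s : R) (f : R -> R) : bmeas f ->
  \int[normal_prob m s]_x f x = \int[mu]_x (f x * normal_pdf m s x).
Proof.
move=> bf; have [mf _] := bf; congr fine.
have dom := normal_prob_dominates m s.
have If : (normal_prob m s).-integrable setT (EFin \o f) by exact: bmeas_integrable.
rewrite -(Radon_Nikodym_change_of_variables dom)//.
apply: ae_eq_integral => //.
- apply: emeasurable_funM; first exact/measurable_EFinP.
  by apply: (measurable_int mu); exact: Radon_Nikodym_integrable.
- apply/measurable_EFinP; apply: measurable_funM => //; exact: measurable_normal_pdf.
- under [X in ae_eq _ _ _ X]eq_fun do rewrite EFinM.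
  apply: ae_eqe_mul2l; apply: integral_ae_eq => //.
  + exact: Radon_Nikodym_integrable.
  + by apply/measurable_EFinP; exact: measurable_normal_pdf.
  + by move=> E _ mE; rewrite -Radon_Nikodym_integral.
Qed.

End normal_density_integral.

(* A single trigonometric integral with a phase [c] handles cosine ([c = 0]) and
   sine ([c = - pi / 2]) at once. *)
Section gaussian_trigonometric_integral.
Variable R : realType.
Notation mu := (@lebesgue_measure R).
Let phi (x : R) : R := normal_pdf 0 1 x.
Let p : R := normal_peak 1.

Let phiE x : phi x = p * expR (- (x ^+ 2 / 2)).
Proof.
rewrite /phi normal_pdfE ?oner_neq0// /normal_fun subr0 expr1n.
by congr (_ * expR _); rewrite mulNr.
Qed.

Let p_gt0 : 0 < p. Proof. by rewrite normal_peak_gt0// oner_neq0. Qed.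

Let phi_ge0 x : 0 <= phi x. Proof. exact: normal_pdf_ge0. Qed.

Let is_derive_phi (x : R) : is_derive x (1 : R) phi (- x * phi x).
Proof.
have -> : phi = (fun x => p * x) \o (expR \o (fun x => - (x ^+ 2 / 2))).
  by apply/funext => y /=; rewrite phiE.
have h1 : is_derive x (1 : R) (fun x : R => - (x ^+ 2 / 2)) (- x).
  rewrite (_ : (fun x => _) = - ((2^-1 : R) \*: (@id R) ^+ 2)).
    by apply: is_derive_eq; rewrite /GRing.scale /=; field.
  by apply/funext => y; rewrite !fctE /GRing.scale/= mulrC.
have h2 := is_derive1_comp (is_derive_expR _) h1.
have h3 y : is_derive y (1 : R) (fun x => p * x) p.
  rewrite (_ : (fun x => _) = p \*: (@id R)); last by apply/funext.
  by apply: is_derive_eq; rewrite /GRing.scale /= mulr1.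
have h4 := @is_derive1_comp R (fun x => p * x) (expR \o (fun x => - (x ^+ 2 / 2))) x _ _ (h3 _) h2.
apply: trigger_derive h4 _.
by rewrite /=; ring.
Qed.

Let measurable_phi : measurable_fun setT phi.
Proof. exact: measurable_normal_pdf. Qed.

Let integrable_phi : mu.-integrable setT (EFin \o phi).
Proof. exact: integrable_normal_pdf. Qed.

(** From |x| <= 1 + x^2 / 4 <= exp (x^2 / 4) the function is dominated by a multiple of the normal
    density of variance 2. *)
Let integrable_xphi : mu.-integrable setT (EFin \o (fun x => `|x| * phi x)).
Proof.
pose s : R := Num.sqrt 2.
have s2 : s ^+ 2 = 2 by rewrite sqr_sqrtr.
have s0 : s != 0 by rewrite gt_eqF// sqrtr_gt0.
pose C := p / normal_peak s.
have IG : mu.-integrable setT (EFin \o (fun x => C * normal_pdf 0 s x)).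
  rewrite (_ : _ \o _ = fun x => C%:E * (normal_pdf 0 s x)%:E)%E; last first.
    by apply/funext => x /=; rewrite EFinM.
  by apply: integrableZl => //; exact: integrable_normal_pdf.
apply: le_integrable IG => //.
- by apply/measurable_EFinP; apply: measurable_funM => //; exact: measurableT_comp.
- move=> x _; rewrite lee_fin normrM normr_id ger0_norm// ger0_norm; last first.
    by rewrite !mulr_ge0// ?normal_pdf_ge0 ?invr_ge0 ?normal_peak_ge0// ltW.
  rewrite phiE normal_pdfE// /normal_fun subr0 s2 /C [in leRHS]mulrA.
  rewrite divfK ?gt_eqF ?normal_peak_gt0// mulrCA ler_pM2l//.
  rewrite -ler_pdivlMr ?expR_gt0// -expRN -expRD.
  have -> : - x ^+ 2 / (2 *+ 2) + - - (x ^+ 2 / 2) = x ^+ 2 / 4 by field.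
  apply: le_trans (expR_ge1Dx _).
  have := sqr_ge0 (1 - `|x| / 2); rewrite sqrrB expr1n exprMn.
  by rewrite real_normK ?num_real// => h; lra.
Qed.

Let measurable_trig (f : R -> R) (t c : R) : continuous f ->
  measurable_fun setT (fun x => f (t * x + c)).
Proof.
move=> cf; apply: measurableT_comp; first exact: continuous_measurable_fun.
by apply: measurable_funD => //; exact: measurable_funM.
Qed.

Let is_derive_lin (t c x : R) : is_derive x (1 : R) (fun x => t * x + c) t.
Proof.
rewrite (_ : (fun x => _) = t \*: (@id R) + cst c); last by apply/funext.
by apply: is_derive_eq; rewrite /GRing.scale /= addr0 mulr1.
Qed.

Let is_derive_lint (t c x : R) : is_derive t (1 : R) (fun t => t * x + c) x.
Proof.
rewrite (_ : (fun t => _) = x \*: (@id R) + cst c); last first.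
  by apply/funext => y; rewrite !fctE /= /GRing.scale/= mulrC.
by apply: is_derive_eq; rewrite /GRing.scale /= addr0 mulr1.
Qed.

Let trig_le1 (x : R) : `|cos x| <= 1 /\ `|sin x| <= 1.
Proof. by rewrite !ler_norml cos_geN1 cos_le1 sin_geN1 sin_le1. Qed.

Let integrable_cos (t c : R) :
  mu.-integrable setT (EFin \o (fun x => cos (t * x + c) * phi x)).
Proof.
apply: le_integrable integrable_phi => //.
  by apply/measurable_EFinP; apply: measurable_funM => //; apply: measurable_trig; exact: continuous_cos.
move=> x _; rewrite lee_fin normrM ler_piMl//; exact: (trig_le1 _).1.
Qed.

Let integrable_xsin (t c : R) :
  mu.-integrable setT (EFin \o (fun x => x * sin (t * x + c) * phi x)).
Proof.
apply: le_integrable integrable_xphi => //.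
  apply/measurable_EFinP; apply: measurable_funM => //; apply: measurable_funM => //.
  by apply: measurable_trig; exact: continuous_sin.
move=> x _; rewrite lee_fin !normrM normr_id ler_wpM2r// ler_piMr//; exact: (trig_le1 _).2.
Qed.

Let phi_nat (n : nat) : phi n%:R <= 2 * p * n.+1%:R^-1.
Proof.
rewrite phiE -mulrA [leRHS]mulrCA ler_pM2l// expRN -[leRHS]invf_div.
rewrite lef_pV2 ?posrE ?expR_gt0 ?divr_gt0//.
apply: le_trans (expR_ge1Dx _); rewrite -natr1.
have nn : n%:R <= n%:R ^+ 2 :> R by rewrite -natrX ler_nat; case: n => // n; rewrite leq_pmulr.
by lra.
Qed.

(** Gaussian integration by parts: the integrand is the derivative of phi(x) sin (t x + c), which
    vanishes at infinity. *)
Let stein (t c : R) :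
  \int[mu]_x (t * (cos (t * x + c) * phi x) - x * sin (t * x + c) * phi x) = 0.
Proof.
pose Psi x := phi x * sin (t * x + c).
pose psi x := t * (cos (t * x + c) * phi x) - x * sin (t * x + c) * phi x.
have dPsi (x : R) : is_derive x (1 : R) Psi (psi x).
  have h1 := @is_derive1_comp R (@sin R) (fun x => t * x + c) x _ _ (is_derive_sin _) (is_derive_lin t c x).
  have h2 := is_deriveM (is_derive_phi x) h1.
  by apply: trigger_derive h2 _; rewrite /psi /GRing.scale /=; ring.
have cphi : continuous phi by apply: continuous_normal_pdf; rewrite oner_neq0.
have clin : continuous (fun x : R => t * x + c).
  by move=> x; apply: cvgD; [apply: cvgM; [exact: cvg_cst|exact: cvg_id]|exact: cvg_cst].
have ccos : continuous (fun x : R => cos (t * x + c)).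
  by move=> x; apply: continuous_comp; [exact: clin|exact: continuous_cos].
have csin : continuous (fun x : R => sin (t * x + c)).
  by move=> x; apply: continuous_comp; [exact: clin|exact: continuous_sin].
have cpsi : continuous psi.
  move=> x; apply: cvgB.
    by apply: cvgM; [exact: cvg_cst|apply: cvgM; [exact: ccos|exact: cphi]].
  by apply: cvgM; [apply: cvgM; [exact: cvg_id|exact: csin]|exact: cphi].
have cPsi : continuous Psi by move=> x; apply: cvgM; [exact: cphi|exact: csin].
have ipsi : mu.-integrable setT (EFin \o psi).
  rewrite (_ : _ \o _ = ((EFin \o (fun x => (t * (cos (t * x + c) * phi x))%R)) \-
     (EFin \o (fun x => x * sin (t * x + c) * phi x)%R))%E); last first.
    by apply/funext => x /=; rewrite EFinB.
  apply: integrableB => //.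
  rewrite (_ : _ \o _ = fun x => (t%:E * (cos (t * x + c) * phi x)%:E)%E); last first.
    by apply/funext => x /=; rewrite EFinM.
  by apply: integrableZl => //; exact: integrable_cos.
pose a (n : nat) : R := n%:R.
(* For n = 0 the interval is degenerate and both sides are 0; the fundamental theorem handles the
   rest. *)
have FTC (n : nat) : \int[mu]_x (psi \_ `[- a n, a n]) x = Psi (a n) - Psi (- a n).
  rewrite -Rintegral_mkcond /Rintegral; case: n => [|n].
    rewrite /a oppr0 subrr set_itv1 integral_set1//; exact/measurable_EFinP/continuous_measurable_fun.
  rewrite (@continuous_FTC2 _ psi Psi)//.
  - by rewrite /a gtrN// ltr0n.
  - exact: continuous_subspaceT.
  - split.
    + by move=> x _; case: (dPsi x).
    + by apply: cvg_at_right_filter; exact: cPsi.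
    + by apply: cvg_at_left_filter; exact: cPsi.
  - by move=> x _; rewrite derive1E; case: (dPsi x).
have lim0 : Psi (a n) - Psi (- a n) @[n --> \oo] --> 0.
  apply: norm_cvg0.
  apply: (@squeeze_cvgr _ _ _ _ (fun=> 0) (fun n => 4 * p * n.+1%:R^-1)).
  - apply: nearW => n; rewrite normr_ge0/=.
    have phiN : phi (- a n) = phi (a n) by rewrite !phiE sqrrN.
    have h x : phi x = phi (a n) -> `|Psi x| <= phi (a n).
      by move=> xn; rewrite /Psi normrM xn ger0_norm// ler_piMr// (trig_le1 _).2.
    rewrite (le_trans (ler_normB _ _))//.
    have -> : 4 * p * n.+1%:R^-1 = 2 * p * n.+1%:R^-1 + 2 * p * n.+1%:R^-1 by ring.
    by apply: lerD; apply: le_trans (phi_nat n); exact: h.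
  - exact: cvg_cst.
  - rewrite -[X in _ --> X](mulr0 (4 * p)); apply: cvgM; first exact: cvg_cst.
    exact: cvg_harmonic.
have lim1 : \int[mu]_x (psi \_ `[- a n, a n]) x @[n --> \oo] --> \int[mu]_x psi x.
  have [If _ cI] : [/\ mu.-integrable setT (EFin \o psi),
      (\int[mu]_x `|((psi \_ `[- a n, a n]) x)%:E - (psi x)%:E| @[n --> \oo] --> 0)%E &
      (\int[mu]_x ((psi \_ `[- a n, a n]) x)%:E @[n --> \oo] --> \int[mu]_x (psi x)%:E)%E].
    apply: (@dominated_convergence _ _ _ mu setT measurableT
      (fun n x => ((psi \_ `[- a n, a n]) x)%:E) (EFin \o psi) (EFin \o (Num.norm \o psi))) => //.
    - move=> n; apply/measurable_EFinP; apply/(measurable_restrictT _ _).1 => //.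
      by apply: measurable_funTS; exact: continuous_measurable_fun.
    - by apply/measurable_EFinP; exact: continuous_measurable_fun.
    - apply: aeW => x _; have [m xm] : exists m : nat, `|x| <= m%:R.
        by exists (Num.truncn `|x|).+1; rewrite ltW// truncnS_gt.
      apply: cvg_near_cst; near=> n; rewrite patchE mem_set//= in_itv/=.
      rewrite -ler_norml (le_trans xm)// ler_nat.
      by near: n; exact: nbhs_infty_ge.
    - exact: integrable_norm.
    - by apply: aeW => x n _; rewrite lee_fin patchE; case: ifP => //; rewrite /= normr0 normr_ge0.
  apply: fine_cvg; rewrite fineK//.
  exact: integrable_fin_num If.
have {}lim0 : \int[mu]_x (psi \_ `[- a n, a n]) x @[n --> \oo] --> 0.
  rewrite (_ : (fun n => _) = (fun n => Psi (a n) - Psi (- a n)))//.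
  by apply/funext => n; exact: FTC.
exact: (cvg_unique _ lim1 lim0).
Unshelve. all: by end_near. Qed.

Let H (c t : R) := \int[mu]_x (cos (t * x + c) * phi x).

(** Differentiation under the integral produces - x sin (t x + c); integration by parts trades the
    factor x for [t] and the sine for the cosine. *)
Let is_derive_H (c t : R) : is_derive t (1 : R) (H c) (- t * H c t).
Proof.
pose f t x := cos (t * x + c) * phi x.
have df (s x : R) : is_derive s (1 : R) (f ^~ x) (- (x * sin (s * x + c) * phi x)).
  have h1 := @is_derive1_comp R (@cos R) (fun s => s * x + c) s _ _ (is_derive_cos _) (is_derive_lint s c x).
  rewrite (_ : f ^~ x = phi x \*: (cos \o (fun s => s * x + c))); last first.
    by apply/funext => y; rewrite /f /= mulrC.
  have h2 := is_deriveZ (phi x) h1.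
  by apply: trigger_derive h2 _; rewrite /GRing.scale /=; ring.
have d1E s x : partial1of2 f s x = - (x * sin (s * x + c) * phi x).
  by rewrite /partial1of2 derive1E; case: (df s x).
have Ia : `]t - 1, t + 1[%classic t by rewrite /= in_itv /=; apply/andP; split; lra.
have If s : `]t - 1, t + 1[%classic s -> mu.-integrable setT (EFin \o f s).
  by move=> _; exact: integrable_cos.
have Id s x : `]t - 1, t + 1[%classic s -> setT x -> derivable (f ^~ x) s 1.
  by move=> _ _; case: (df s x).
have Gub s x : `]t - 1, t + 1[%classic s -> setT x ->
    `|partial1of2 f s x| <= `|x| * phi x.
  move=> _ _; rewrite d1E normrN !normrM (ger0_norm (phi_ge0 x)) ler_wpM2r// ler_piMr//.
  exact: (trig_le1 _).2.
have G0 x : 0 <= `|x| * phi x by rewrite mulr_ge0.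
have D := derivable_under_integral measurableT Ia If Id G0 integrable_xphi Gub.
have E := differentiation_under_integral measurableT Ia If Id G0 integrable_xphi Gub.
apply: DeriveDef; first exact: D.
rewrite -derive1E E.
have i1 : mu.-integrable setT (EFin \o (fun x => t * (cos (t * x + c) * phi x))).
  rewrite (_ : _ \o _ = fun x => (t%:E * (cos (t * x + c) * phi x)%:E)%E); last first.
    by apply/funext => x /=; rewrite EFinM.
  by apply: integrableZl => //; exact: integrable_cos.
under eq_Rintegral => x _ do rewrite d1E -mulN1r.
rewrite RintegralZl//.
have := stein t c; rewrite RintegralB//.
rewrite RintegralZl//.
by move=> /eqP; rewrite subr_eq0 => /eqP <-; rewrite mulN1r mulNr.
Qed.

(** Integrating factor: H exp (t^2 / 2) has derivative 0, and its value at 0 is cos c. *)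
Let HE (c t : R) : H c t = cos c * expR (- (t ^+ 2 / 2)).
Proof.
pose K s := H c s * expR (s ^+ 2 / 2).
have dK (s : R) : is_derive s (1 : R) K 0.
  have h1 : is_derive s (1 : R) (fun x : R => x ^+ 2 / 2) s.
    rewrite (_ : (fun x => _) = ((2^-1 : R) \*: (@id R) ^+ 2)).
      by apply: is_derive_eq; rewrite /GRing.scale /=; field.
    by apply/funext => y; rewrite !fctE /GRing.scale/= mulrC.
  have h2 := is_derive1_comp (is_derive_expR _) h1.
  have h3 := is_deriveM (is_derive_H c s) h2.
  by apply: trigger_derive h3 _; rewrite /GRing.scale /=; ring.
have := is_derive_0_is_cst t 0 dK.
rewrite /K expr0n /= mul0r expR0 mulr1 => KE.
rewrite expRN -[LHS](mulfK (lt0r_neq0 (expR_gt0 (t ^+ 2 / 2)))) KE; congr (_ / _).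
rewrite /H; under eq_Rintegral => x _ do rewrite mul0r add0r.
rewrite RintegralZl//.
by rewrite /Rintegral integral_normal_pdf mulr1.
Qed.

Lemma normal_prob_cos (t : R) :
  \int[normal_prob 0 1]_x cos (t * x) = expR (- (t ^+ 2 / 2)).
Proof.
rewrite integral_normal_prob; last by apply: bmeas_cos; exact: measurable_funM.
have := HE 0 t; rewrite cos0 mul1r => <-.
by apply: eq_Rintegral => x _; rewrite addr0.
Qed.

Lemma normal_prob_sin (t : R) : \int[normal_prob 0 1]_x sin (t * x) = 0.
Proof.
rewrite integral_normal_prob; last by apply: bmeas_sin; exact: measurable_funM.
have := HE (- (pi / 2)) t; rewrite cosN cos_pihalf mul0r => H0; rewrite -[RHS]H0.
by apply: eq_Rintegral => x _; rewrite cosBpihalf.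
Qed.

End gaussian_trigonometric_integral.

Section standard_normal_characteristic.
Context d (T : measurableType d) (R : realType) (P : probability T R).
Variable N : {RV P >-> R}.
Hypothesis N_normal : standard_normal N.

Lemma standard_normal_expect (f : R -> R) : bmeas f ->
  \int[P]_x f (N x) = \int[normal_prob 0 1]_x f x.
Proof.
move=> [mf [M fM]].
have mN : measurable_fun setT (N : T -> measurableTypeR R) by exact: (measurable_funPT N).
pose N' : {mfun T >-> measurableTypeR R} := @mfun_Sub _ _ T (measurableTypeR R) N (mem_set mN).
have mf' : measurable_fun setT (EFin \o f : measurableTypeR R -> \bar R).
  exact/measurable_EFinP.
rewrite /Rintegral; congr fine.
rewrite -[LHS](@integral_distribution _ _ _ _ _ P N' _ mf'); last first.
  apply: bmeas_integrable; split; first by apply: (measurableT_comp (f := f)).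
  by exists M => x; exact: fM.
by apply: eq_measure_integral => A mA _; exact: N_normal.
Qed.

Lemma standard_normal_cos (t : R) :
  \int[P]_x cos (t * N x) = expR (- (t ^+ 2 / 2)).
Proof.
rewrite (standard_normal_expect (f := fun x => cos (t * x))) ?normal_prob_cos//.
by apply: bmeas_cos; exact: measurable_funM.
Qed.

Lemma standard_normal_sin (t : R) : \int[P]_x sin (t * N x) = 0.
Proof.
rewrite (standard_normal_expect (f := fun x => sin (t * x))) ?normal_prob_sin//.
by apply: bmeas_sin; exact: measurable_funM.
Qed.

Lemma standard_normal_pt (x : R) : P (N @^-1` [set x]) = 0%E.
Proof.
have -> : P (N @^-1` [set x]) = normal_prob 0 1 [set x] by exact: N_normal.
have /null_content_dominatesP := @normal_prob_dominates R 0 1.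
by apply => //; exact: lebesgue_measure_set1.
Qed.

End standard_normal_characteristic.

(** * Laplace transform of the bootstrap statistic *)

Lemma cvg_sum (R : realType) (I : Type) (s : seq I) (f : I -> nat -> R) (l : I -> R) :
  (forall i, f i n @[n --> \oo] --> l i) ->
  \sum_(i <- s) f i n @[n --> \oo] --> \sum_(i <- s) l i.
Proof.
by move=> fl; apply: cvg_big => // -[x y]; exact: add_continuous.
Qed.

Section expectation_swap.
Context d1 d2 (T1 : measurableType d1) (T2 : measurableType d2) (R : realType)
  (P1 : probability T1 R) (P2 : probability T2 R).

Lemma expect_swap (h : T1 * T2 -> R) : bmeas h ->
  \int[P1]_x \int[P2]_y h (x, y) = \int[P2]_y \int[P1]_x h (x, y).
Proof.
move=> [mh [M hM]].
have b1 x : bmeas (fun y => h (x, y)).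
  split; last by exists M => y; exact: hM.
  by apply: (measurableT_comp (f := h)) => //; exact: measurable_fun_pair.
have b2 y : bmeas (fun x => h (x, y)).
  split; last by exists M => x; exact: hM.
  by apply: (measurableT_comp (f := h)) => //; exact: measurable_fun_pair.
have ih : (P1 \x P2)%E.-integrable setT (EFin \o h).
  apply: measurable_bounded_integrable => //.
    by apply: (le_lt_trans (@probability_le1 _ _ _ (P1 \x P2)%E _ measurableT)); rewrite ltry.
  exists M; split; first exact: num_real.
  by move=> x Mx y _ /=; exact: (le_trans (hM y) (ltW Mx)).
have := Fubini ih; rewrite /Rintegral => E; congr fine.
transitivity (\int[P1]_x \int[P2]_y (EFin \o h) (x, y))%E.
  by apply: eq_integral => x _; rewrite -/(Rintegral _ _ _) -EFin_expect.
by rewrite E; apply: eq_integral => y _; rewrite -/(Rintegral _ _ _) -EFin_expect.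
Qed.

Lemma measurable_expect (h : T1 * T2 -> R) : bmeas h ->
  measurable_fun setT (fun x => \int[P2]_y h (x, y)).
Proof.
move=> [mh [M hM]].
have b1 x : bmeas (fun y => h (x, y)).
  split; last by exists M => y; exact: hM.
  by apply: (measurableT_comp (f := h)) => //; exact: measurable_fun_pair.
have ih : (P1 \x P2)%E.-integrable setT (EFin \o h).
  apply: measurable_bounded_integrable => //.
    by apply: (le_lt_trans (@probability_le1 _ _ _ (P1 \x P2)%E _ measurableT)); rewrite ltry.
  exists M; split; first exact: num_real.
  by move=> x Mx y _ /=; exact: (le_trans (hM y) (ltW Mx)).
apply/measurable_EFinP.
rewrite (_ : EFin \o _ = fubini_F P2 (EFin \o h)); first exact: measurable_fubini_F ih.
by apply/funext => x /=; rewrite -EFin_expect.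
Qed.

End expectation_swap.

Section bootstrap_clt.
Context (R : realType) dS (OmegaS : measurableType dS) (PS : probability OmegaS R).
Variable idx : forall n : nat, 'I_n -> {RV PS >-> nat}.
Hypothesis idx_indep : forall n, mutually_independent (@idx n).
Hypothesis idx_unif : forall n (k : 'I_n), uniform_below n (@idx n k).

(** The n-th power of the comparison value is exactly the limit, and passing from one draw to n
    draws costs 2 n times the error of one draw, which [cvg_phase] sends to 0. *)
Lemma bootstrap_cos_cvg (a : nat -> R) (s2 : R) :
  n%:R^-1 * (\sum_(i < n) a i) @[n --> \oo] --> 0 ->
  n%:R^-1 * (\sum_(i < n) a i ^+ 2) @[n --> \oo] --> s2 ->
  \int[PS]_ws cos (\sum_(k < n) centered_scaled a n (@idx n k ws))
    @[n --> \oo] --> expR (- (s2 / 2)).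
Proof.
move=> ma sa; have s20 := msq_limit_ge0 sa.
have ph := cvg_phase ma sa.
set E := fun n => n%:R * _ in ph.
apply/subr_cvg0; apply: norm_cvg0.
have ph2 : 2 * E n @[n --> \oo] --> 0.
  by rewrite -[X in _ --> X](mulr0 2); apply: cvgM => //; exact: cvg_cst.
apply: (@squeeze_cvgr _ _ _ _ (fun=> 0) (fun n => 2 * E n)); [|exact: cvg_cst|exact: ph2].
near=> n; rewrite normr_ge0/=.
have n0 : (0 < n)%N by near: n; exact: nbhs_infty_gt.
have nR0 : n%:R != 0 :> R by rewrite pnatr_eq0 -lt0n.
pose g (k : 'I_n) (m : nat) : R := centered_scaled a n m.
have mg k : measurable_fun setT (g k) by [].
have bc (k : 'I_n) : \int[PS]_x cos (g k (@idx n k x)) =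
    n%:R^-1 * \sum_(i < n) cos (centered_scaled a n i).
  rewrite (uniform_below_expect n0 (idx_unif k) (f := fun m => cos (centered_scaled a n m)))//.
  by exists 1 => m; rewrite ler_norml cos_geN1 cos_le1.
have bs (k : 'I_n) : \int[PS]_x sin (g k (@idx n k x)) =
    n%:R^-1 * \sum_(i < n) sin (centered_scaled a n i).
  rewrite (uniform_below_expect n0 (idx_unif k) (f := fun m => sin (centered_scaled a n m)))//.
  by exists 1 => m; rewrite ler_norml sin_geN1 sin_le1.
have c01 : 0 <= expR (- (s2 / (2 * n%:R))) <= 1.
  by rewrite expR_ge0 -expR0 ler_expR oppr_le0 divr_ge0.
have := expect_cos_approx (@idx_indep n) mg bc bs c01 (index_enum_uniq 'I_n).
have -> : size (index_enum 'I_n) = n by rewrite [index_enum _]unlock -enumT size_enum_ord.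
rewrite -expRM_natl.
have -> : n%:R * - (s2 / (2 * n%:R)) = - (s2 / 2) by field.
rewrite /E mulrA => h; apply: le_trans h.
by rewrite lerDl.
Unshelve. all: by end_near. Qed.

End bootstrap_clt.

Section bootstrap_laplace.
Context (R : realType) (d : nat) (Omega : Type) dS (OmegaS : measurableType dS)
  (PS : probability OmegaS R) dN (OmegaN : measurableType dN) (PN : probability OmegaN R).
Variable idx : forall n : nat, 'I_n -> {RV PS >-> nat}.
Hypothesis idx_indep : forall n, mutually_independent (@idx n).
Hypothesis idx_unif : forall n (k : 'I_n), uniform_below n (@idx n k).
Variable N : 'I_d -> {RV PN >-> R}.
Hypothesis N_indep : mutually_independent (P := PN) N.
Hypothesis N_normal : forall i, standard_normal (N i).
Variables (X : nat -> Omega -> 'rV[R]_d) (w : Omega) (G Q : 'M[R]_d) (lambda : 'I_d -> R).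
Hypothesis mean_cvg : forall l,
  n%:R^-1 * (\sum_(i < n) X i w 0 l) @[n --> \oo] --> 0.
Hypothesis cov_cvg : forall l l',
  n%:R^-1 * (\sum_(i < n) X i w 0 l * X i w 0 l') @[n --> \oo] --> G l l'.
Hypothesis QQ : Q *m Q^T = 1%:M.
Hypothesis QGQ : Q *m G *m Q^T = diag_mx (\row_i lambda i).

Let bm n ws := @boot_mean R d Omega _ OmegaS PS X idx n w ws.
Let stat n ws := @boot_stat R d Omega _ OmegaS PS X idx n w ws.
Let Y n (j : 'I_d) ws : R := Num.sqrt n%:R * (bm n ws *m Q^T) 0 j.
(** The scalar product of an observation with the vector of rotated coordinates [t]; <t, Y_n> is
    obtained by resampling this real sequence. *)
Let proj (t : 'rV[R]_d) i : R := (X i w *m (t *m Q)^T) 0 0.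

Let stat_Y n ws : stat n ws = \sum_j Y n j ws ^+ 2.
Proof.
rewrite /stat /boot_stat /enorm sqr_sqrtr; last by apply: sumr_ge0 => j _; exact: sqr_ge0.
rewrite /Y; under [RHS]eq_bigr => j _ do rewrite exprMn sqr_sqrtr ?ler0n//.
rewrite -mulr_sumr -/(bm n ws); congr (_ * _).
have E (v : 'rV[R]_d) : \sum_j v 0 j ^+ 2 = (v *m v^T) 0 0.
  by rewrite mxE; apply: eq_bigr => j _; rewrite mxE expr2.
rewrite !E trmx_mul trmxK mulmxA -(mulmxA _ Q^T Q).
by rewrite (mulmx1C QQ) mulmx1.
Qed.

Let proj_mean (t : 'rV[R]_d) : n%:R^-1 * (\sum_(i < n) proj t i) @[n --> \oo] --> 0.
Proof.
have -> : (fun n => n%:R^-1 * (\sum_(i < n) proj t i)) =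
    (fun n => \sum_l (n%:R^-1 * (\sum_(i < n) X i w 0 l)) * (t *m Q) 0 l).
  apply/funext => n; under [RHS]eq_bigr => l _ do rewrite -mulrA mulr_suml.
  rewrite -mulr_sumr exchange_big /=; congr (_ * _); apply: eq_bigr => i _.
  by rewrite /proj mxE; apply: eq_bigr => l _; rewrite [(t *m Q)^T _ _]mxE.
rewrite [X in _ --> X](_ : _ = \sum_(l < d) 0 * (t *m Q) 0 l); last first.
  by rewrite big1// => l _; rewrite mul0r.
apply: (@cvg_sum _ _ _ (fun l n =>
  (n%:R^-1 * (\sum_(i < n) X i w 0 l)) * (t *m Q) 0 l)) => l.
apply: cvgM => //; exact: cvg_cst.
Qed.

(** The mean of squares is a quadratic form in u = t Q whose coefficients are the empirical second
    moments. All [t] are served by the same [w]. *)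
Let proj_msq (t : 'rV[R]_d) : n%:R^-1 * (\sum_(i < n) proj t i ^+ 2) @[n --> \oo] -->
  \sum_j lambda j * t 0 j ^+ 2.
Proof.
pose u := t *m Q.
have -> : (fun n => n%:R^-1 * (\sum_(i < n) proj t i ^+ 2)) =
    (fun n => \sum_l \sum_l' (n%:R^-1 * (\sum_(i < n) X i w 0 l * X i w 0 l')) * (u 0 l * u 0 l')).
  apply/funext => n.
  under [RHS]eq_bigr => l _ do under eq_bigr => l' _ do rewrite -mulrA mulr_suml.
  under [RHS]eq_bigr => l _ do rewrite -mulr_sumr exchange_big /=.
  rewrite -mulr_sumr exchange_big /=; congr (_ * _); apply: eq_bigr => i _.
  have -> : proj t i = \sum_l X i w 0 l * u 0 l.
    by rewrite /proj mxE; apply: eq_bigr => l _; rewrite [(t *m Q)^T _ _]mxE.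
  rewrite expr2 mulr_suml; apply: eq_bigr => l _; rewrite mulr_sumr.
  by apply: eq_bigr => l' _; ring.
have -> : \sum_j lambda j * t 0 j ^+ 2 = \sum_l \sum_l' G l l' * (u 0 l * u 0 l').
  have <- : (t *m (Q *m G *m Q^T) *m t^T) 0 0 = \sum_j lambda j * t 0 j ^+ 2.
    rewrite QGQ mxE; apply: eq_bigr => j _; rewrite mul_mx_diag !mxE; ring.
  have -> : t *m (Q *m G *m Q^T) *m t^T = u *m (G *m u^T).
    by rewrite /u trmx_mul !mulmxA.
  rewrite mxE; apply: eq_bigr => l _; rewrite [(G *m _) _ _]mxE mulr_sumr.
  by apply: eq_bigr => l' _; rewrite [u^T _ _]mxE; ring.
apply: (@cvg_sum _ _ _ (fun l n => \sum_l' (n%:R^-1 *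
  (\sum_(i < n) X i w 0 l * X i w 0 l')) * (u 0 l * u 0 l'))) => l.
apply: (@cvg_sum _ _ _ (fun l' n => (n%:R^-1 *
  (\sum_(i < n) X i w 0 l * X i w 0 l')) * (u 0 l * u 0 l'))) => l'.
apply: cvgM => //; exact: cvg_cst.
Qed.

(** At a basis vector the limit of the means of squares is [lambda j] itself. *)
Lemma cov_eigenvalue_ge0 j : 0 <= lambda j.
Proof.
have := msq_limit_ge0 (@proj_msq (delta_mx 0 j)).
rewrite (bigD1 j)//= big1 => [|i /negPf ij].
  by rewrite mxE !eqxx expr1n mulr1 addr0.
by rewrite mxE ij andbF expr0n mulr0.
Qed.

Let sum_Y n ws (t : 'rV[R]_d) : (0 < n)%N ->
  \sum_j t 0 j * Y n j ws = \sum_(k < n) centered_scaled (proj t) n (@idx n k ws).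
Proof.
move=> n0; have nR : n%:R != 0 :> R by rewrite pnatr_eq0 -lt0n.
have s0 : Num.sqrt n%:R != 0 :> R by rewrite gt_eqF// sqrtr_gt0 ltr0n.
transitivity (Num.sqrt n%:R * (bm n ws *m (t *m Q)^T) 0 0).
  rewrite trmx_mul mulmxA [in RHS]mxE mulr_sumr; apply: eq_bigr => j _.
  by rewrite [t^T _ _]mxE /Y; ring.
rewrite /centered_scaled -mulr_suml /bm /boot_mean -scalemxAl mxE mulmx_suml summxE.
have -> : \sum_(k < n) ((resample X idx k w ws - sample_mean X n w) *m (t *m Q)^T) 0 0 =
    \sum_(k < n) (proj t (@idx n k ws) - n%:R^-1 * \sum_(i < n) proj t i).
  apply: eq_bigr => k _; rewrite mulmxBl mxE; congr (_ + _).
  rewrite mxE /sample_mean -scalemxAl mxE mulmx_suml summxE; congr (- (_ * _)).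
move: (\sum_(k < n) _) => S.
have -> : n%:R^-1 = (Num.sqrt n%:R)^-1 * (Num.sqrt n%:R)^-1 :> R.
  by rewrite -invfM -expr2 sqr_sqrtr.
by field.
Qed.

Let measurable_Y n j : measurable_fun setT (Y n j).
Proof.
rewrite /Y; apply: measurable_funM => //.
rewrite (_ : (fun _ => _) = fun ws => \sum_l bm n ws 0 l * Q j l); last first.
  by apply/funext => ws; rewrite mxE; apply: eq_bigr => l _; rewrite [Q^T _ _]mxE.
apply: measurable_sum => l; apply: measurable_funM => //.
rewrite (_ : (fun ws => _) = fun ws => n%:R^-1 *
    \sum_(k < n) (X (@idx n k ws) w 0 l - sample_mean X n w 0 l)); last first.
  apply/funext => ws; rewrite /bm /boot_mean mxE summxE; congr (_ * _).
  by apply: eq_bigr => k _; rewrite !mxE.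
apply: measurable_funM => //; apply: measurable_sum => k; apply: measurable_funB => //.
exact: (measurableT_comp (f := fun m : nat => X m w 0 l)).
Qed.

Lemma boot_laplace_cvg (m : R) : 0 <= m ->
  \int[PS]_ws expR (- (m * stat n ws)) @[n --> \oo] -->
  \int[PN]_x expR (- (m * weighted_chi2 lambda N x)).
Proof.
move=> m0; pose s := Num.sqrt (2 * m).
have s2 : s ^+ 2 = 2 * m by rewrite sqr_sqrtr// mulr_ge0.
(* Gaussian linearization: [exp (- m |y|^2)] is the average over [N] of [cos (s <N, y>)]. *)
have lin n ws : expR (- (m * stat n ws)) =
    \int[PN]_x cos (\sum_j (s * Y n j ws) * N j x).
  have mg (j : 'I_d) : measurable_fun setT (fun z : R => (s * Y n j ws) * z).
    exact: measurable_funM.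
  have [-> _] := expect_trig_gaussian (s := index_enum 'I_d) N_indep mg
    (fun j => standard_normal_cos (N_normal j) (s * Y n j ws))
    (fun j => standard_normal_sin (N_normal j) (s * Y n j ws)) (index_enum_uniq _).
  congr (expR (- _)); under eq_bigr => j _ do rewrite exprMn s2.
  by rewrite -mulr_sumr -stat_Y; field.
pose f n x := \int[PS]_ws cos (\sum_j (s * Y n j ws) * N j x).
have swap n : \int[PS]_ws expR (- (m * stat n ws)) = \int[PN]_x f n x.
  under eq_Rintegral => ws _ do rewrite lin.
  rewrite (@expect_swap _ _ _ _ _ PS PN (fun z => cos (\sum_j (s * Y n j z.1) * N j z.2)))//.
  apply: bmeas_cos; apply: measurable_sum => j; apply: measurable_funM.
    by apply: measurable_funM => //; exact: (measurableT_comp (measurable_Y n j)).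
  exact: measurableT_comp.
have mf n : measurable_fun setT (f n).
  apply: (measurable_expect PN PS (h := fun z => cos (\sum_j (s * Y n j z.2) * N j z.1))).
  apply: bmeas_cos; apply: measurable_sum => j; apply: measurable_funM.
    by apply: measurable_funM => //; exact: (measurableT_comp (measurable_Y n j)).
  exact: measurableT_comp.
under eq_fun do rewrite swap.
apply: (@cvg_expect_bounded _ _ _ _ _ _ 1) => //.
- apply: measurableT_comp => //; apply: measurableT_comp => //.
  by apply: measurable_funM => //; exact: measurable_weighted_chi2.
- move=> n x; apply: expect_norm_le => [|ws].
    apply: bmeas_cos; apply: measurable_sum => j; apply: measurable_funM => //.
    exact: measurable_funM.
  by rewrite ler_norml cos_geN1 cos_le1.
(* For fixed [x] the one-dimensional limit theorem applies in the direction s N(x); the outer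
   average over [x] follows by dominated convergence. *)
move=> x; pose t : 'rV[R]_d := \row_j (s * N j x).
have B := bootstrap_cos_cvg idx_indep idx_unif (@proj_mean t) (@proj_msq t).
have E : (\sum_j lambda j * t 0 j ^+ 2) / 2 = m * weighted_chi2 lambda N x.
  rewrite /weighted_chi2 mulr_sumr mulr_suml; apply: eq_bigr => j _.
  by rewrite /t mxE exprMn s2; field.
rewrite E in B.
apply: cvg_trans B; apply: near_eq_cvg; near=> n.
have n0 : (0 < n)%N by near: n; exact: nbhs_infty_gt.
apply: eq_Rintegral => ws _; rewrite -sum_Y//; congr cos.
by apply: eq_bigr => j _; rewrite /t mxE; ring.
Unshelve. all: by end_near. Qed.

End bootstrap_laplace.

(** * From Laplace transforms to weak convergence *)

Section bernstein.
Variable R : realType.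

(** At y this is the expectation of f(B) for B binomial with parameters n and y, by conditioning on
    one trial; no binomial coefficient appears. The argument of [f] is the count k, not k / n. *)
Fixpoint bernstein (n : nat) (f : nat -> R) : {poly R} :=
  if n is n'.+1 then 'X * bernstein n' (f \o S) + (1 - 'X) * bernstein n' f
  else (f 0%N)%:P.

Let bern n f y := (bernstein n f).[y].

Let bernS n f y : bern n.+1 f y = y * bern n (f \o S) y + (1 - y) * bern n f y.
Proof. by rewrite /bern /= !hornerE. Qed.

Let bern0 f y : bern 0 f y = f 0%N. Proof. by rewrite /bern /= hornerE. Qed.

Let bern_le n f g y : 0 <= y <= 1 -> (forall k, (k <= n)%N -> f k <= g k) ->
  bern n f y <= bern n g y.
Proof.
move=> /andP[y0 y1]; elim: n f g => [|n IH] f g fg; first by rewrite !bern0 fg.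
rewrite !bernS lerD// ler_wpM2l ?subr_ge0// IH// => k kn; apply: fg => //.
exact: leq_trans kn _.
Qed.

Let bern_affine n (a b : R) f y :
  bern n (fun k => a + b * f k) y = a + b * bern n f y.
Proof.
elim: n f => [|n IH] f; first by rewrite !bern0.
by rewrite !bernS (IH (f \o S)) IH; ring.
Qed.

(** Squared bias plus binomial variance. The center [c] is general because the induction shifts it
    by 1. *)
Let bern_sqr n (c y : R) :
  bern n (fun k => (k%:R - c) ^+ 2) y = (n%:R * y - c) ^+ 2 + n%:R * (y * (1 - y)).
Proof.
elim: n c => [|n IH] c; first by rewrite bern0 !mul0r addr0.
rewrite bernS.
have -> : (fun k => (k%:R - c) ^+ 2) \o S = fun k => (k%:R - (c - 1)) ^+ 2.
  by apply/funext => k /=; rewrite -natr1; congr (_ ^+ 2); ring.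
by rewrite !IH -natr1; ring.
Qed.

(** The increment of [h] is at most e / 2 near y, by uniform continuity, and away from y at most a
    multiple of the squared distance, whose binomial mean is a variance. *)
Lemma weierstrass_approx (h : R -> R) (e : R) : continuous h -> 0 < e ->
  exists p : {poly R}, forall y, 0 <= y <= 1 -> `|h y - p.[y]| <= e.
Proof.
move=> ch e0.
have cI : compact `[(0:R), 1]%classic by exact: segment_compact.
have [M [_ HM]] : bounded_set (h @` `[(0:R), 1]%classic).
  apply: compact_bounded; apply: continuous_compact => //.
  exact: continuous_subspaceT.
pose M1 := Num.max 1 (M + 1).
have M1gt0 : 0 < M1 by rewrite /M1 lt_max ltr01.
have hM y : 0 <= y <= 1 -> `|h y| <= M1.
  move=> y01; apply: (HM M1); first by rewrite /M1 lt_max ltrDl ltr01 orbT.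
  by exists y => //=; rewrite in_itv.
have [de de0 Hde] : exists2 de : R, 0 < de & forall x y : R, 0 <= x <= 1 -> 0 <= y <= 1 ->
    `|x - y| < de -> `|h x - h y| <= e / 2.
  pose Q (de x : R) := forall y, 0 <= y <= 1 -> `|x - y| < de -> `|h x - h y| <= e / 2.
  have Qnear : \forall de \near (0:R)^'+, `[(0:R), 1]%classic `<=` Q de.
    move/compact_near_coveringP : cI; apply => x x01.
    have e4 : 0 < e / 4 by rewrite divr_gt0.
    have /cvgrPdist_le/(_ _ e4)/nbhs_ballP[r /= r0 Hr] := ch x.
    have r2 : 0 < r / 2 by rewrite divr_gt0.
    exists (ball x (r / 2), [set de | de < r / 2]) => /=.
      by split; [exact: nbhsx_ballx|exact: nbhs_right_lt].
    move=> [x' de] /= [xx' der] y y01 x'y.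
    rewrite /ball /= in xx'.
    have h1 : `|h x - h x'| <= e / 4.
      by apply: Hr; rewrite /ball /= (lt_trans xx')// ltr_pdivrMr// ltr_pMr// ltr1n.
    have h2 : `|h x - h y| <= e / 4.
      apply: Hr; rewrite /ball /= -(subrKA x') (le_lt_trans (ler_normD _ _))//.
      have -> : r = r / 2 + r / 2 by field.
      by rewrite ltrD// (lt_trans x'y).
    rewrite -(subrKA (h x)) (le_trans (ler_normD _ _))// distrC.
    have -> : e / 2 = e / 4 + e / 4 by field.
    by rewrite lerD.
  have [de [de0 Hde]] := filter_ex (filterI (nbhs_right_gt (0:R)) Qnear).
  exists de => // x y x01 y01 xy.
  have xI : `[(0:R), 1]%classic x by rewrite /= in_itv.
  exact: (Hde x xI y y01 xy).
(* This size keeps the variance term, at most 2 M1 / (de^2 (n + 1)), below e / 2. *)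
have [n Hn] : exists n : nat, 4 * M1 / (de ^+ 2 * e) <= n.+1%:R.
  by exists (Num.truncn (4 * M1 / (de ^+ 2 * e))); rewrite ltW// truncnS_gt.
have nR : 0 < n.+1%:R :> R by [].
exists (bernstein n.+1 (fun k => h (k%:R / n.+1%:R))) => y y01.
rewrite -/(bern n.+1 _ y).
(* If |k / (n + 1) - y| >= de, then [C] times (k - (n + 1) y)^2 is at least 2 M1, which bounds any
   increment of [h]. *)
pose C := 2 * M1 / (de ^+ 2 * n.+1%:R ^+ 2).
have C0 : 0 <= C by rewrite divr_ge0 ?mulr_ge0 ?sqr_ge0// ltW.
have [y0 y1] : 0 <= y /\ y <= 1 by apply/andP.
have Cn : C * (n.+1%:R * (y * (1 - y))) <= e / 2.
  apply: (@le_trans _ _ (C * n.+1%:R)).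
    rewrite ler_wpM2l// -[leRHS]mulr1 ler_wpM2l//; nra.
  have -> : C * n.+1%:R = 2 * M1 / de ^+ 2 / n.+1%:R by rewrite /C; field; rewrite gt_eqF//= gt_eqF.
  rewrite ler_pdivrMr//; move: Hn; rewrite ler_pdivrMr ?mulr_gt0 ?exprn_gt0// => Hn.
  by rewrite ler_pdivrMr ?exprn_gt0//; lra.
have key k : (k <= n.+1)%N ->
    `|h (k%:R / n.+1%:R) - h y| <= e / 2 + C * (k%:R - n.+1%:R * y) ^+ 2.
  move=> kn; have k01 : 0 <= (k%:R / n.+1%:R : R) <= 1.
    apply/andP; split; first by apply: divr_ge0.
    by rewrite ler_pdivrMr// mul1r ler_nat.
  have sq0 : 0 <= C * (k%:R - n.+1%:R * y) ^+ 2 by rewrite mulr_ge0 ?sqr_ge0.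
  have [kde|dek] := ltP `|k%:R / n.+1%:R - y| de.
    by rewrite (le_trans (Hde _ _ k01 y01 kde))// lerDl.
  have dek2 : de ^+ 2 <= (k%:R / n.+1%:R - y) ^+ 2.
    by rewrite -[leRHS]real_normK ?num_real// ler_pXn2r// ?nnegrE// ltW.
  have CE : C * (k%:R - n.+1%:R * y) ^+ 2 = 2 * M1 / de ^+ 2 * (k%:R / n.+1%:R - y) ^+ 2.
    by rewrite /C; field; rewrite !gt_eqF.
  have : 2 * M1 <= C * (k%:R - n.+1%:R * y) ^+ 2.
    by rewrite CE mulrAC ler_pdivlMr ?exprn_gt0// ler_pM2l// mulr_gt0.
  have := hM _ k01; have := hM _ y01; have := ler_normB (h (k%:R / n.+1%:R)) (h y); lra.
(* The values s = 1 and s = -1 give the upper and the lower bound. *)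
have B (s : R) : bern n.+1 (fun k => (h y + s * (e / 2)) + (s * C) * (k%:R - n.+1%:R * y) ^+ 2) y
    = h y + s * (e / 2) + s * (C * (n.+1%:R * (y * (1 - y)))).
  by rewrite bern_affine bern_sqr subrr expr0n/= add0r !mulrA.
have up : bern n.+1 (fun k => h (k%:R / n.+1%:R)) y <= h y + 1 * (e / 2) + 1 * (C * (n.+1%:R * (y * (1 - y)))).
  rewrite -B; apply: bern_le => // k kn; have := key k kn; rewrite ler_norml => /andP[_]; lra.
have lo : h y + -1 * (e / 2) + -1 * (C * (n.+1%:R * (y * (1 - y)))) <= bern n.+1 (fun k => h (k%:R / n.+1%:R)) y.
  rewrite -B; apply: bern_le => // k kn; have := key k kn; rewrite ler_norml => /andP[+ _]; lra.
by rewrite ler_norml; apply/andP; split; lra.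
Qed.

End bernstein.

(** * Continuity theorem for Laplace transforms at the integers *)

Section continuity_theorem.
Context (R : realType) dS (OmegaS : measurableType dS) (PS : probability OmegaS R)
  dN (OmegaN : measurableType dN) (PN : probability OmegaN R).
Variables (V_ : nat -> {RV PS >-> R}) (V : {RV PN >-> R}).
Hypothesis V_ge0 : forall n x, 0 <= V_ n x.
Hypothesis V0 : forall x, 0 <= V x.
Hypothesis laplace_cvg : forall m : nat,
  \int[PS]_x expR (- (m%:R * V_ n x)) @[n --> \oo] --> \int[PN]_x expR (- (m%:R * V x)).

Let mexp d (T : measurableType d) (W : T -> R) (m : R) : measurable_fun setT W ->
  measurable_fun setT (fun x => expR (- (m * W x))).
Proof.
move=> mW; apply: measurableT_comp => //; apply: measurableT_comp => //.
exact: measurable_funM.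
Qed.

Let bexp d (T : measurableType d) (W : T -> R) (m : nat) : measurable_fun setT W ->
  (forall x, 0 <= W x) -> bmeas (fun x => expR (- (m%:R * W x))).
Proof.
move=> mW W0; split; first exact: mexp.
by exists 1 => x; rewrite ger0_norm ?expR_ge0// -expR0 ler_expR oppr_le0 mulr_ge0.
Qed.

Let poly_expect d (T : measurableType d) (P : probability T R) (W : T -> R)
    (p : {poly R}) : measurable_fun setT W -> (forall x, 0 <= W x) ->
  bmeas (fun x => p.[expR (- W x)]) /\
  \int[P]_x p.[expR (- W x)] =
    \sum_(i < size p) p`_i * \int[P]_x expR (- (i%:R * W x)).
Proof.
move=> mW W0.
have E x : p.[expR (- W x)] = \sum_(i < size p) p`_i * expR (- (i%:R * W x)).
  by rewrite horner_coef; apply: eq_bigr => i _; rewrite -expRM_natl mulrN.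
have b (i : 'I_(size p)) : bmeas (fun x => p`_i * expR (- (i%:R * W x))).
  by apply: bmeasM; [exact: bmeas_cst|exact: bexp].
have [bS ES] := expect_sum P (index_enum _) b.
under eq_Rintegral => x _ do rewrite E.
rewrite (_ : (fun x => p.[_]) = fun x => \sum_(i < size p) p`_i * expR (- (i%:R * W x))); last first.
  by apply/funext => x; exact: E.
split=> //; rewrite ES; apply: eq_bigr => i _; rewrite expectZ//; exact: bexp.
Qed.

Let poly_cvg (p : {poly R}) :
  \int[PS]_x p.[expR (- V_ n x)] @[n --> \oo] --> \int[PN]_x p.[expR (- V x)].
Proof.
have [_ ->] := poly_expect PN p (measurable_funPT V) V0.
rewrite (_ : (fun n => _) = fun n =>
   \sum_(i < size p) p`_i * \int[PS]_x expR (- (i%:R * V_ n x))); last first.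
  by apply/funext => n; have [_ ->] := poly_expect PS p (measurable_funPT (V_ n)) (V_ge0 n).
apply: (@cvg_sum R _ _ (fun (i : 'I_(size p)) n => p`_i * \int[PS]_x expR (- (i%:R * V_ n x)))) => i.
by apply: cvgM; [exact: cvg_cst|exact: laplace_cvg].
Qed.

Let bcomp d (T : measurableType d) (W : T -> R) (h : R -> R) :
  measurable_fun setT W -> bmeas h -> bmeas (fun x => h (W x)).
Proof.
move=> mW [mh [M hM]]; split; first exact: (measurableT_comp mh).
by exists M => x; exact: hM.
Qed.

Let mexpN d (T : measurableType d) (W : T -> R) : measurable_fun setT W ->
  measurable_fun setT (fun x => expR (- W x)).
Proof. by move=> mW; apply: measurableT_comp => //; exact: measurableT_comp. Qed.

Let exp01 d (T : measurableType d) (W : T -> R) x : (forall x, 0 <= W x) ->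
  0 <= expR (- W x) <= 1.
Proof. by move=> W0; rewrite expR_ge0 -expR0 ler_expR oppr_le0 W0. Qed.

Let exp_cvg (h : R -> R) : continuous h -> bmeas h ->
  \int[PS]_x h (expR (- V_ n x)) @[n --> \oo] --> \int[PN]_x h (expR (- V x)).
Proof.
move=> ch bh; apply/cvgrPdist_le => e e0.
have e3 : 0 < e / 3 by rewrite divr_gt0.
have [p hp] := weierstrass_approx ch e3.
have approx d (T : measurableType d) (P : probability T R) (W : T -> R) :
    measurable_fun setT W -> (forall x, 0 <= W x) ->
    `|\int[P]_x h (expR (- W x)) - \int[P]_x p.[expR (- W x)]| <= e / 3.
  move=> mW W0; have [bp _] := poly_expect P p mW W0.
  have bhW : bmeas (fun x => h (expR (- W x))) by apply: bcomp => //; exact: mexpN.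
  rewrite -expectB//; apply: expect_norm_le; first exact: bmeasB.
  by move=> x; apply: hp; exact: exp01.
have /cvgrPdist_le/(_ _ e3) := @poly_cvg p.
apply: filterS => n Hn.
have h1 := approx _ _ PS _ (measurable_funPT (V_ n)) (V_ge0 n).
have h2 := approx _ _ PN _ (measurable_funPT V) V0.
move: Hn h1 h2; set A := \int[PN]_x p.[_]; set B := \int[PS]_x p.[_].
set A' := \int[PN]_x h _; set B' := \int[PS]_x h _ => Hn h1 h2.
have -> : A' - B' = (A' - A) + (A - B) - (B' - B) by ring.
rewrite (le_trans (ler_normB _ _))//.
have := ler_normD (A' - A) (A - B); lra.
Qed.

(** A continuous cutoff, equal to 1 up to c - 1 and to 0 from c on. *)
Let clamp (c v : R) : R := Num.max 0 (Num.min 1 (c - v)).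

Let clamp01 c v : 0 <= clamp c v <= 1.
Proof. by rewrite /clamp le_max lexx/= ge_max ler01/= ge_min lexx. Qed.

Let continuous_clamp c : continuous (clamp c).
Proof.
move=> v; apply: (@continuous_max R R (cst 0) (fun v => Num.min 1 (c - v)) v).
  exact: cvg_cst.
apply: (@continuous_min R R (cst 1) (fun v => c - v) v); first exact: cvg_cst.
by apply: cvgB; [exact: cvg_cst|exact: cvg_id].
Qed.

(* [f] times a cutoff at level [c] is rewritten as [h (expR (- v))] with [h]
   continuous on the whole line. *)
Let cutoff_cvg (f : R -> R) (c : R) : continuous f -> bmeas f ->
  \int[PS]_x (f (V_ n x) * clamp c (V_ n x)) @[n --> \oo] -->
  \int[PN]_x (f (V x) * clamp c (V x)).
Proof.
move=> cf bf; pose de := expR (- c).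
(* The floor exp (- c) keeps the logarithm away from 0; it acts only beyond [c], where the cutoff
   vanishes. *)
pose L (y : R) := - ln (Num.max y de).
pose h y := f (L y) * clamp c (L y).
have cL : continuous L.
  move=> y; apply: cvgN; apply: (cvg_comp (fun y : R => Num.max y de) (@ln R)).
    by apply: (@continuous_max R R idfun (cst de) y); [exact: cvg_id|exact: cvg_cst].
  by apply: continuous_ln; rewrite lt_max expR_gt0 orbT.
have ch : continuous h.
  move=> y; apply: cvgM.
    by apply: (cvg_comp L f); [exact: cL|exact: cf].
  by apply: (cvg_comp L (clamp c)); [exact: cL|exact: continuous_clamp].
have bh : bmeas h.
  split; first exact: continuous_measurable_fun.
  have [_ [M fM]] := bf; exists M => y.
  have /andP[c0 c1] := clamp01 c (L y).
  by rewrite /h normrM (ger0_norm c0) -[M]mulr1 ler_pM.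
have hE v : h (expR (- v)) = f v * clamp c v.
  rewrite /h /L; have [vc|cv] := leP v c.
    by rewrite max_l ?expRK ?opprK// ler_expR lerN2.
  rewrite max_r; last by rewrite ler_expR lerN2 ltW.
  rewrite expRK opprK.
  have -> : clamp c c = 0 by rewrite /clamp subrr min_r// maxxx.
  have -> : clamp c v = 0.
    rewrite /clamp min_r; last by rewrite lerBlDr; apply: (le_trans (ltW cv)); rewrite lerDr.
    by rewrite max_l// subr_le0 ltW.
  by rewrite !mulr0.
have := exp_cvg ch bh.
under eq_fun do under eq_Rintegral => x _ do rewrite hE.
by under [in X in _ --> X -> _]eq_Rintegral => x _ do rewrite hE.
Qed.

(** The mass beyond the cutoff is small for [V] by dominated convergence, and for [V_ n] with n
    large because the expectations of the cutoff itself converge. *)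
Lemma laplace_continuity (f : R -> R) : continuous f -> (exists M, forall x, `|f x| <= M) ->
  \int[PS]_x f (V_ n x) @[n --> \oo] --> \int[PN]_x f (V x).
Proof.
move=> cf [M fM].
have mf : measurable_fun setT f by exact: continuous_measurable_fun.
have bf : bmeas f by split=> //; exists M.
have M0 : 0 <= M by rewrite (le_trans _ (fM 0)).
have bcl c : bmeas (clamp c).
  split; first by apply: continuous_measurable_fun; exact: continuous_clamp.
  by exists 1 => v; have /andP[? ?] := clamp01 c v; rewrite ger0_norm.
have cutoff d (T : measurableType d) (P : probability T R) (W : T -> R) c :
    measurable_fun setT W ->
    `|\int[P]_x f (W x) - \int[P]_x (f (W x) * clamp c (W x))| <=
    M * (1 - \int[P]_x (1 * clamp c (W x))).
  move=> mW.
  have bfW : bmeas (fun x => f (W x)) by exact: bcomp.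
  have bcW : bmeas (fun x => clamp c (W x)) by exact: bcomp.
  have b1 : bmeas (fun x : T => 1 - clamp c (W x)) by apply: bmeasB => //; exact: bmeas_cst.
  rewrite -expectB//; last exact: bmeasM.
  under [in leRHS]eq_Rintegral => x _ do rewrite mul1r.
  rewrite -[X in M * (X - _)](expect_cst P) -expectB//; last exact: bmeas_cst.
  rewrite -expectZ//.
  apply: le_trans (le_normr_Rintegral _ _) _ => //.
    by apply: bmeas_integrable; apply: bmeasB => //; exact: bmeasM.
  apply: expect_le.
  - have [m1 [C hC]] : bmeas (fun x => f (W x) - f (W x) * clamp c (W x)).
      by apply: bmeasB => //; exact: bmeasM.
    by split; [exact: measurableT_comp|exists C => x; rewrite normr_id].
  - by apply: bmeasM => //; exact: bmeas_cst.
  - move=> x; have /andP[c0 c1] := clamp01 c (W x).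
    have -> : f (W x) - f (W x) * clamp c (W x) = f (W x) * (1 - clamp c (W x)) by ring.
    by rewrite normrM [X in _ * X]ger0_norm ?subr_ge0// ler_wpM2r// subr_ge0.
have lim1 : \int[PN]_x (1 * clamp k%:R (V x)) @[k --> \oo] --> (1 : R).
  rewrite -[X in _ --> X](expect_cst PN).
  apply: (@cvg_expect_bounded _ _ _ _ _ _ 1) => //.
  - move=> k; apply: measurable_funM => //.
    by apply: measurableT_comp => //; apply: continuous_measurable_fun; exact: continuous_clamp.
  - by move=> k x; rewrite mul1r; have /andP[? ?] := clamp01 k%:R (V x); rewrite ger0_norm.
  move=> x; have [m Vm] : exists m : nat, V x + 1 <= m%:R.
    by exists (Num.truncn (V x + 1)).+1; rewrite ltW// truncnS_gt.
  apply: cvg_near_cst; near=> k; rewrite mul1r /clamp min_l ?max_r// lerBrDl.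
  apply: (le_trans Vm); rewrite ler_nat; near: k; exact: nbhs_infty_ge.
apply/cvgrPdist_le => e e0.
have M1 : 0 < M + 1 by rewrite ltr_wpDl.
(* The three errors M e', 2 M e' and e' add up to at most 5 (M + 1) e' = e. *)
pose e' := e / (5 * (M + 1)).
have e'0 : 0 < e' by rewrite divr_gt0// mulr_gt0.
have /cvgrPdist_le/(_ _ e'0) [k _ Hk] := lim1.
have {}Hk := Hk k (leqnn k).
pose c : R := k%:R.
have b1 : bmeas (fun _ : R => 1 : R) by exact: bmeas_cst.
have c1 : continuous (fun _ : R => 1 : R) by move=> ?; exact: cvg_cst.
have /cvgrPdist_le/(_ _ e'0) C1 := @cutoff_cvg (fun=> 1) c c1 b1.
have /cvgrPdist_le/(_ _ e'0) C2 := @cutoff_cvg f c cf bf.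
near=> n.
have h1 := cutoff _ _ PN _ c (measurable_funPT V).
have h2 := cutoff _ _ PS _ c (measurable_funPT (V_ n)).
have h3 : `|\int[PN]_x (1 * clamp c (V x)) - \int[PS]_x (1 * clamp c (V_ n x))| <= e'.
  by near: n.
have h4 : `|\int[PN]_x (f (V x) * clamp c (V x)) - \int[PS]_x (f (V_ n x) * clamp c (V_ n x))| <= e'.
  by near: n.
move: Hk h1 h2 h3 h4; rewrite -/c.
set A := \int[PN]_x f _; set B := \int[PS]_x f _.
set A1 := \int[PN]_x (1 * _); set B1 := \int[PS]_x (1 * _).
set A2 := \int[PN]_x (f _ * _); set B2 := \int[PS]_x (f _ * _) => Hk h1 h2 h3 h4.
have {}Hk : 1 - A1 <= e' by move: Hk; rewrite ler_norml => /andP[].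
have {}h3 : 1 - B1 <= 2 * e' by move: h3; rewrite ler_norml => /andP[]; lra.
have {}h1 : `|A - A2| <= M * e' by apply: (le_trans h1); rewrite ler_wpM2l.
have {}h2 : `|B - B2| <= M * (2 * e') by apply: (le_trans h2); rewrite ler_wpM2l.
have eE : e = 5 * (M * e') + 5 * e' by rewrite /e'; field; rewrite gt_eqF.
have -> : A - B = (A - A2) + (A2 - B2) - (B - B2) by ring.
rewrite (le_trans (ler_normB _ _))//.
have Me : 0 <= M * e' by rewrite mulr_ge0// ltW.
have := ler_normD (A - A2) (A2 - B2); lra.
Unshelve. all: by end_near. Qed.

End continuity_theorem.

(** * Uniform convergence of distribution functions *)

Section distribution_function.
Context d (T : measurableType d) (R : realType) (P : probability T R).
Variable V : {RV P >-> R}.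

Definition dfun (x : R) : R := \int[P]_w \1_(V @^-1` `]-oo, x]%classic) w.

Lemma dfunE x : cdf V x = (dfun x)%:E.
Proof. by rewrite /dfun expect_indic//; exact: measurable_funPTI. Qed.

Lemma dfun_nondecreasing : {homo dfun : x y / x <= y}.
Proof. by move=> x y xy; rewrite -lee_fin -!dfunE cdf_nondecreasing. Qed.

Lemma dfun01 x : 0 <= dfun x <= 1.
Proof. by rewrite -!lee_fin -dfunE cdf_le1 cdf_ge0. Qed.

(** For e > 0, linear from 1 at [x] to 0 at x + e and constant outside: a continuous function
    between two indicators of half-lines. *)
Definition ramp (x e v : R) : R := Num.max 0 (Num.min 1 ((x + e - v) / e)).

Lemma continuous_ramp x e : continuous (ramp x e).
Proof.
move=> v; apply: (@continuous_max R R (cst 0) (fun v => Num.min 1 ((x + e - v) / e)) v).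
  exact: cvg_cst.
apply: (@continuous_min R R (cst 1) (fun v => (x + e - v) / e) v); first exact: cvg_cst.
by apply: cvgM; [apply: cvgB; [exact: cvg_cst|exact: cvg_id]|exact: cvg_cst].
Qed.

Lemma ramp01 x e v : 0 <= ramp x e v <= 1.
Proof. by rewrite /ramp le_max lexx/= ge_max ler01/= ge_min lexx. Qed.

Lemma bmeas_ramp x e : bmeas (fun w => ramp x e (V w)).
Proof.
split; last by exists 1 => w; have /andP[? ?] := ramp01 x e (V w); rewrite ger0_norm.
apply: (measurableT_comp (f := ramp x e)) => //.
by apply: continuous_measurable_fun; exact: continuous_ramp.
Qed.

Let bind x : bmeas (fun w => \1_(V @^-1` `]-oo, x]%classic) w : R).
Proof. by apply: bmeas_indic; exact: measurable_funPTI. Qed.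

Lemma dfun_le_ramp x e : 0 < e -> dfun x <= \int[P]_w ramp x e (V w).
Proof.
move=> e0; apply: expect_le => //; first exact: bmeas_ramp.
move=> w; rewrite indicE; have [|_] := boolP (w \in _); last first.
  by case/andP: (ramp01 x e (V w)).
rewrite inE /= in_itv/= => Vx.
rewrite /ramp min_l ?le_max ?lexx ?orbT//.
by rewrite ler_pdivlMr// mul1r; lra.
Qed.

Lemma ramp_le_dfun x e : 0 < e -> \int[P]_w ramp x e (V w) <= dfun (x + e).
Proof.
move=> e0; apply: expect_le => //; first exact: bmeas_ramp.
move=> w; rewrite indicE; have [|] := boolP (w \in _).
  by case/andP: (ramp01 x e (V w)).
rewrite notin_setE /= in_itv/= => /negP; rewrite -ltNge => Vx.
rewrite /ramp max_l// ge_min; apply/orP; right.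
by rewrite ler_pdivrMr// mul0r subr_le0 ltW.
Qed.

Hypothesis no_atom : forall x, P (V @^-1` [set x]) = 0%E.

(** Closed intervals shrinking to [x] have probabilities tending to that of the point, which is
    0. *)
Lemma dfun_gap x e : 0 < e -> exists2 de : R, 0 < de & dfun (x + de) - dfun (x - de) <= e.
Proof.
move=> e0; pose A (k : nat) : set T := V @^-1` `[x - k.+1%:R^-1, x + k.+1%:R^-1]%classic.
have mA k : measurable (A k) by exact: measurable_funPTI.
have : P (A k) @[k --> \oo] --> P (\bigcap_k A k).
  apply: nonincreasing_cvg_mu => //.
  - by apply: (le_lt_trans (probability_le1 P _)); rewrite ?ltry.
  - exact: bigcap_measurable.
  - move=> k l kl; apply/subsetPset => w; rewrite /A /= !in_itv/= => /andP[h1 h2].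
    have : l.+1%:R^-1 <= k.+1%:R^-1 :> R by rewrite lef_pV2 ?posrE// ler_nat.
    move: h1 h2; move: (l.+1%:R^-1) (k.+1%:R^-1) => a b h1 h2 h.
    by apply/andP; split; lra.
have -> : \bigcap_k A k = V @^-1` [set x].
  apply/seteqP; split => [w Aw|w /= Vx k _]; last first.
    have k0 : 0 < k.+1%:R^-1 :> R by rewrite invr_gt0.
    rewrite /A /= Vx in_itv/=; move: k0; move: (k.+1%:R^-1) => a k0.
    by apply/andP; split; lra.
  apply/eqP; rewrite -subr_eq0 -normr_le0; apply/ler_addgt0Pr => r r0.
  have [k kr] : exists k : nat, k.+1%:R^-1 < r.
    by exists (Num.truncn r^-1); rewrite invf_plt ?posrE//; exact: truncnS_gt.
  have := Aw k I; rewrite /A /= in_itv/=; move: kr; move: (k.+1%:R^-1) => a ar /andP[h1 h2].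
  by rewrite add0r ler_norml; apply/andP; split; lra.
rewrite no_atom => /fine_cvgP[_] /cvgr0Pnorm_le/(_ _ e0)[k _ Hk].
have k0 : 0 < k.+2%:R^-1 :> R by rewrite invr_gt0.
exists k.+2%:R^-1 => //.
have := Hk k (leqnn k); rewrite ger0_norm ?fine_ge0//; apply: le_trans.
have fA : P (A k) \is a fin_num by apply: fin_num_measure; exact: mA.
rewrite lerBlDr -lee_fin EFinD [X in (X + _)%E]fineK// -!dfunE /cdf /distribution /pushforward.
apply: (@le_trans _ _ (P (A k `|` V @^-1` `]-oo, x - k.+2%:R^-1]%classic))).
  apply: le_measure; rewrite ?inE; [exact: measurable_funPTI|by apply: measurableU => //; exact: measurable_funPTI|].
  have kk : k.+2%:R^-1 <= k.+1%:R^-1 :> R by rewrite lef_pV2 ?posrE// ler_nat.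
  move=> w; rewrite /A /= !in_itv/=; move: kk; move: (k.+2%:R^-1) (k.+1%:R^-1) => a b ab Vx.
  by have [?|?] := leP (V w) (x - a); [right|left; apply/andP; split; lra].
by apply: measureU2 => //; exact: measurable_funPTI.
Qed.

Let continuous_dfun : continuous dfun.
Proof.
move=> x; apply/cvgrPdist_le => e e0; have [de de0 Hde] := dfun_gap x e0.
near=> y.
have : `|x - y| < de by near: y; apply/nbhs_ballP; exists de.
rewrite ltr_norml => /andP[h1 h2].
have l1 : dfun (x - de) <= dfun x by apply: dfun_nondecreasing; lra.
have l2 : dfun x <= dfun (x + de) by apply: dfun_nondecreasing; lra.
have l3 : dfun (x - de) <= dfun y by apply: dfun_nondecreasing; lra.
have l4 : dfun y <= dfun (x + de) by apply: dfun_nondecreasing; lra.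
by rewrite ler_norml; apply/andP; split; lra.
Unshelve. all: by end_near. Qed.

Lemma dfun_quantile p : 0 < p < 1 -> exists x, dfun x = p.
Proof.
move=> /andP[p0 p1].
have [b pb] : exists b, p <= dfun b.
  have /fine_cvgP[_] := cvg_cdfy1 V.
  move=> /cvgr_ge/(_ _ p1)[b [_ Hb]]; exists (b + 1).
  by have := Hb (b + 1); rewrite /= dfunE /=; apply; rewrite ltrDl.
have [a pa] : exists a, dfun a <= p.
  have /fine_cvgP[_] := cvg_cdfNy0 V.
  move=> /cvgr_le/(_ _ p0)[a [_ Ha]]; exists (a - 1).
  by have := Ha (a - 1); rewrite /= dfunE /=; apply; rewrite ltrBlDr ltrDl.
pose c := Num.max a b.
have pc : p <= dfun c by rewrite (le_trans pb)// dfun_nondecreasing// /c le_max lexx orbT.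
have ac : a <= c by rewrite /c le_max lexx.
have ap : dfun a <= dfun c by exact: dfun_nondecreasing.
have [|y _ Hy] := @IVT _ dfun a c p ac (continuous_subspaceT continuous_dfun).
  by rewrite min_l// max_r// pa pc.
by exists y.
Qed.

End distribution_function.

Section polya.
Context (R : realType) dS (OmegaS : measurableType dS) (PS : probability OmegaS R)
  dN (OmegaN : measurableType dN) (PN : probability OmegaN R).
Variables (V_ : nat -> {RV PS >-> R}) (V : {RV PN >-> R}).
Hypothesis V_cvg : forall f : R -> R, continuous f -> (exists M, forall x, `|f x| <= M) ->
  \int[PS]_x f (V_ n x) @[n --> \oo] --> \int[PN]_x f (V x).
Hypothesis no_atom : forall x, PN (V @^-1` [set x]) = 0%E.

Let ramp_cvg x e :
  \int[PS]_w ramp x e (V_ n w) @[n --> \oo] --> \int[PN]_w ramp x e (V w).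
Proof.
apply: V_cvg; first exact: continuous_ramp.
by exists 1 => v; have /andP[? ?] := ramp01 x e v; rewrite ger0_norm.
Qed.

(** The ramps starting at [x] and at x - de bound from above and below; the slack is the increase of
    the limit function from x - de to x + de. *)
Lemma dfun_cvg x : dfun (V_ n) x @[n --> \oo] --> dfun V x.
Proof.
apply/cvgrPdist_le => e e0; have e2 : 0 < e / 2 by rewrite divr_gt0.
have [de de0 Hde] := dfun_gap no_atom x e2.
have l1 : dfun V (x - de) <= dfun V x by apply: dfun_nondecreasing; lra.
have l2 : dfun V x <= dfun V (x + de) by apply: dfun_nondecreasing; lra.
have /cvgrPdist_le/(_ _ e2) C1 := @ramp_cvg x de.
have /cvgrPdist_le/(_ _ e2) C2 := @ramp_cvg (x - de) de.
near=> n.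
have : `|\int[PN]_w ramp x de (V w) - \int[PS]_w ramp x de (V_ n w)| <= e / 2 by near: n.
rewrite ler_norml => /andP[h1 _].
have : `|\int[PN]_w ramp (x - de) de (V w) - \int[PS]_w ramp (x - de) de (V_ n w)| <= e / 2.
  by near: n.
rewrite ler_norml => /andP[_ h2].
have u1 := dfun_le_ramp (V_ n) x de0; have u2 := ramp_le_dfun V x de0.
have u3 := dfun_le_ramp V (x - de) de0; have u4 := ramp_le_dfun (V_ n) (x - de) de0.
rewrite subrK in u4.
by rewrite ler_norml; apply/andP; split; lra.
Unshelve. all: by end_near. Qed.

(** Pointwise convergence on the finite grid of quantiles of levels i / M suffices: between grid
    points both functions are controlled by monotonicity, at the price of at most two steps 1 /
    M. *)
Lemma dfun_unif (e : R) : 0 < e ->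
  \forall n \near \oo, forall x, `|dfun (V_ n) x - dfun V x| <= e.
Proof.
move=> e0.
have [m me] : exists m : nat, 4 / e <= m.+1%:R.
  by exists (Num.truncn (4 / e)); rewrite ltW// truncnS_gt.
have [M ME] : exists M : R, M = m.+1%:R by exists m.+1%:R.
have M0 : 0 < M by rewrite ME ltr0n.
have Me : 2 / M <= e / 2.
  by rewrite ler_pdivrMr// mulrAC ler_pdivlMr//; move: me; rewrite ler_pdivrMr// -ME; lra.
have e2 : 0 < e / 2 by rewrite divr_gt0.
(* A quantile of level 0 need not exist, so index 0 receives an arbitrary point with no condition
   attached. *)
have qx (i : 'I_m.+1) : exists x, (0 < i)%N -> dfun V x = i%:R / M.
  have [->|i0] := posnP i; first by exists 0.
  have [|x xE] := @dfun_quantile _ _ _ _ V no_atom (i%:R / M); last by exists x.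
  by rewrite divr_gt0 ?ltr0n//= ltr_pdivrMr// mul1r ME ltr_nat.
have [q Hq] := choice qx.
have : \forall n \near \oo, forall i : 'I_m.+1, `|dfun V (q i) - dfun (V_ n) (q i)| <= e / 2.
  apply: filter_forall => i.
  by have /cvgrPdist_le/(_ _ e2) := @dfun_cvg (q i).
apply: filterS => n Hn x.
have /andP[F0 F1] := dfun01 V x; have /andP[G0 G1] := dfun01 (V_ n) x.
have [i /andP[i1 i2]] : exists i : nat, i%:R <= dfun V x * M < i.+1%:R.
  by exists (Num.truncn (dfun V x * M)); apply: truncn_itv; rewrite mulr_ge0// ltW.
have j1 : i%:R / M <= dfun V x by rewrite ler_pdivrMr.
have j2 : dfun V x < i.+1%:R / M by rewrite ltr_pdivlMr.
have jE : i.+1%:R / M = i%:R / M + 1 / M by rewrite -natr1 mulrDl.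
have M1 : 2 / M = 1 / M + 1 / M by rewrite -mulrDl.
have M10 : 0 < 1 / M by rewrite divr_gt0.
have up : dfun (V_ n) x <= dfun V x + e.
  have [im|im] := ltnP i.+1 m.+1; last first.
    have : 1 <= i.+1%:R / M by rewrite ler_pdivlMr// mul1r ME ler_nat.
    by move: jE; lra.
  have Hi := Hq (Ordinal im) isT; rewrite /= in Hi.
  have xq : x <= q (Ordinal im).
    rewrite leNgt; apply/negP => /ltW/(dfun_nondecreasing V); rewrite Hi leNgt.
    by rewrite j2.
  have := dfun_nondecreasing (V_ n) xq.
  have := Hn (Ordinal im); rewrite ler_norml Hi => /andP[]; lra.
have lo : dfun V x - e <= dfun (V_ n) x.
  (* For i <= 1 the limit function at [x] is below 2 / M <= e / 2 and the bound is trivial.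
     Otherwise the grid point one index lower is taken: its level is strictly below the value at
     [x], which puts it to the left of [x], whereas the point of level i / M may lie to the right on
     a flat stretch. *)
  case: i i1 i2 j1 j2 jE => [|[|i]] i1 i2 j1 j2 jE.
  - by move: jE j2; rewrite mul0r; lra.
  - by move: jE j2; rewrite -/(1 : R); lra.
  have im : (i.+1 < m.+1)%N.
    rewrite -(@ltr_nat R) (lt_le_trans (_ : _ < i.+2%:R)) ?ltr_nat//.
    by rewrite -ME (le_trans i1)// ger_pMl.
  have Hi := Hq (Ordinal im) isT; rewrite /= in Hi.
  have iE : i.+2%:R / M = i.+1%:R / M + 1 / M by rewrite -natr1 mulrDl.
  have xq : q (Ordinal im) <= x.
    rewrite leNgt; apply/negP => /ltW/(dfun_nondecreasing V); rewrite Hi; lra.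
  have := dfun_nondecreasing (V_ n) xq.
  have := Hn (Ordinal im); rewrite ler_norml Hi => /andP[]; lra.
by rewrite ler_norml; apply/andP; split; lra.
Qed.

Lemma polya : ereal_sup (range (fun x : R => `|cdf (V_ n) x - cdf V x|%E))
  @[n --> \oo] --> 0%E.
Proof.
pose s n := ereal_sup (range (fun x : R => `|cdf (V_ n) x - cdf V x|%E)).
have s0 n : (0 <= s n)%E.
  by apply: (@le_trans _ _ `|cdf (V_ n) 0 - cdf V 0|%E) => //; apply: ereal_sup_ubound; exists 0.
have se (e : R) : 0 < e -> \forall n \near \oo, (s n <= e%:E)%E.
  move=> e0; apply: filterS (dfun_unif e0) => n Hn.
  by apply: ge_ereal_sup => _ [x _ <-]; rewrite !dfunE -EFinB lee_fin.
apply/fine_cvgP; split.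
  apply: filterS (se 1 ltr01) => n sn.
  by rewrite (ge0_fin_numE (s0 n)); apply: (le_lt_trans sn); rewrite ltry.
apply/cvgr0Pnorm_le => e e0; apply: filterS (se e e0) => n sn.
rewrite /= ger0_norm; last by apply: fine_ge0; exact: s0.
rewrite -lee_fin fineK//.
by rewrite (ge0_fin_numE (s0 n)); apply: (le_lt_trans sn); rewrite ltry.
Qed.

End polya.

(** * The limit law and the sample moments *)

Section weighted_chi2_no_atom.
Context d (T : measurableType d) (R : realType) (P : probability T R).
Variables (k : nat) (lambda : 'I_k -> R) (N : 'I_k -> {RV P >-> R}).
Hypothesis N_indep : mutually_independent N.
Hypothesis N_normal : forall i, standard_normal (N i).

(** Given the other summands, the event confines [N j] to the two square roots of a number;
    independence and Fubini make this conditioning rigorous. *)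
Lemma weighted_chi2_no_atom (j : 'I_k) (x : R) : 0 < lambda j ->
  P (weighted_chi2 lambda N @^-1` [set x]) = 0%E.
Proof.
move=> lj; pose s := [seq i <- index_enum 'I_k | i != j].
pose g (i : 'I_k) (y : R) := lambda i * y ^+ 2.
have mg i : measurable_fun setT (g i).
  by apply: measurable_funM => //; exact: measurable_funX.
have js : j \notin s by rewrite mem_filter eqxx.
have ind := mutually_independent_sum N_indep js mg.
pose W w := \sum_(i <- s) g i (N i w).
have mW : measurable_fun setT W.
  by apply: measurable_sum => i; apply: (measurableT_comp (mg i)).
pose W' : {mfun T >-> R} := mfun_Sub (mem_set mW).
have ind' : indep2 P W' (N j).
  by move=> A B mA mB; rewrite setIC muleC; exact: ind.
have chiE w : weighted_chi2 lambda N w = W w + lambda j * N j w ^+ 2.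
  by rewrite /weighted_chi2 (bigD1 j)//= addrC /W big_filter.
pose h (z : R * R) : R := \1_[set x] (z.1 + lambda j * z.2 ^+ 2).
have bh : bmeas h.
  split; last by exists 1 => z; rewrite /h indicE ger0_norm//; case: (_ \in _).
  apply: (measurableT_comp (f := \1_[set x] : R -> R)); first exact: measurable_indic.
  by apply: measurable_funD => //; apply: measurable_funM => //; exact: measurable_funX.
have mV : measurable (weighted_chi2 lambda N @^-1` [set x]).
  by rewrite -[X in measurable X]setTI; exact: measurable_weighted_chi2.
rewrite -expect_indic//; congr EFin.
transitivity (\int[P]_w h (W' w, N j w)).
  by apply: eq_Rintegral => w _; rewrite /h [in RHS]/= -chiE.
rewrite (indep2_integral ind' bh).
rewrite -[RHS](expect_cst P); apply: eq_Rintegral => w _.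
(* For a negative radicand the square root is 0 by convention; the equation then has no solution, so
   the bound still holds. *)
pose a := Num.sqrt ((x - W w) / lambda j).
have mN y : measurable (N j @^-1` [set y]) by exact: measurable_funPTI.
have b1 y : bmeas (fun z => \1_(N j @^-1` [set y]) z : R) by exact: bmeas_indic.
have I0 y : \int[P]_z (\1_(N j @^-1` [set y]) z : R) = 0.
  by apply: EFin_inj; rewrite expect_indic//; exact: standard_normal_pt.
have bhw : bmeas (fun z => h (W' w, N j z)).
  have [mh [M hM]] := bh; split; last by exists M => z; exact: hM.
  by apply: (measurableT_comp mh); exact: measurable_fun_pair.
apply/eqP; rewrite eq_le; apply/andP; split; last first.
  by apply: Rintegral_ge0 => z _; rewrite /h indicE; case: (_ \in _).
apply: (@le_trans _ _ (\int[P]_z (\1_(N j @^-1` [set a]) z + \1_(N j @^-1` [set - a]) z))); last first.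
  by rewrite expectD// !I0 addr0.
apply: expect_le => //; first exact: bmeasD.
move=> z; rewrite /h /= indicE; have [|_] := boolP (_ \in _); last by rewrite addr_ge0.
rewrite inE /= => E.
have N2 : N j z ^+ 2 = (x - W w) / lambda j by rewrite -E; field; rewrite gt_eqF.
have : `|N j z| = a by rewrite /a -N2 sqrtr_sqr.
move=> <-; have [N0|/ltW N0] := leP 0 (N j z).
  by rewrite ger0_norm// [X in X + _]indicE mem_set// lerDl.
by rewrite ler0_norm// opprK [X in _ + X]indicE mem_set// lerDr.
Qed.

End weighted_chi2_no_atom.

Section borel_row_vector.
Variables (R : realType) (d : nat).

Lemma measurable_coord (j : 'I_d) :
  measurable_fun setT (fun v : borel_rV R d => (v : 'rV[R]_d) 0 j).
Proof.
apply: (measurability _ (RGenOpens.measurableE R)) => _ [_ [a [b ->] <-]].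
rewrite setTI; apply: sub_sigma_algebra.
have /continuousP := @coord_continuous R 1 d 0 j; apply; exact: interval_open.
Qed.

End borel_row_vector.

Section sample_moments.
Context (R : realType) (d : nat) dO (Omega : measurableType dO) (P : probability Omega R).
Variable X : nat -> {RV P >-> borel_rV R d}.
Hypothesis X_iid : iid X.
Hypothesis X_centered : forall j : 'I_d, ('E_P[fun w => ((X 0%N w : 'rV[R]_d) 0 j)%R] = 0)%E.
Hypothesis X_sq_integrable : ('E_P[fun w => (enorm (X 0%N w : 'rV[R]_d) ^+ 2)%R] < +oo)%E.

Let c (i : nat) (l : 'I_d) (w : Omega) : R := (X i w : 'rV[R]_d) 0 l.
Let e (w : Omega) : R := \sum_l c 0 l w ^+ 2.

Let measurable_c i l : measurable_fun setT (c i l).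
Proof. by apply: (measurableT_comp (measurable_coord l)). Qed.

Let measurable_e : measurable_fun setT e.
Proof. by apply: measurable_sum => l; exact: measurable_funX. Qed.

Let e_ge0 w : 0 <= e w.
Proof. by apply: sumr_ge0 => l _; exact: sqr_ge0. Qed.

Let c_le_e l w : c 0 l w ^+ 2 <= e w.
Proof. by rewrite /e (bigD1 l)//= lerDl sumr_ge0// => i _; exact: sqr_ge0. Qed.

Let integrable_e : P.-integrable setT (EFin \o e).
Proof.
apply/integrableP; split; first exact/measurable_EFinP.
apply: le_lt_trans X_sq_integrable; rewrite unlock.
rewrite le_eqVlt; apply/orP; left; apply/eqP; apply: eq_integral => w _ /=.
by rewrite ger0_norm ?e_ge0// /enorm sqr_sqrtr//; exact: (e_ge0 w).
Qed.

Let integrable_cc l l' : P.-integrable setT (fun w => (c 0 l w * c 0 l' w)%:E).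
Proof.
apply: le_integrable integrable_e => //.
  by apply/measurable_EFinP; exact: measurable_funM.
move=> w _; rewrite lee_fin (ger0_norm (e_ge0 w)) normrM.
have := c_le_e l w; have := c_le_e l' w; have := sqr_ge0 (`|c 0 l w| - `|c 0 l' w|).
by rewrite sqrrB !real_normK ?num_real//; lra.
Qed.

Let integrable_c l : P.-integrable setT (fun w => (c 0 l w)%:E).
Proof.
have I1 : P.-integrable setT (EFin \o (fun w => 1 + e w)).
  rewrite (_ : _ \o _ = ((EFin \o (fun=> 1%R)) \+ (EFin \o e))%E); last first.
    by apply/funext => w /=; rewrite EFinD.
  by apply: integrableD => //; apply: bmeas_integrable; exact: bmeas_cst.
apply: le_integrable I1 => //; first exact/measurable_EFinP.
move=> w _; rewrite lee_fin (ger0_norm (addr_ge0 ler01 (e_ge0 w))).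
have := c_le_e l w; have := sqr_ge0 (`|c 0 l w| - 1).
by rewrite sqrrB expr1n real_normK ?num_real//; have := normr_ge0 (c 0 l w); lra.
Qed.

Let expect_c l : \int[P]_w c 0 l w = 0.
Proof. by have := X_centered l; rewrite unlock /Rintegral => ->. Qed.

Lemma cov_mxE l l' : cov_mx P (X 0%N) l l' = \int[P]_w (c 0 l w * c 0 l' w).
Proof.
rewrite mxE unlock !X_centered unlock; congr fine; apply: eq_integral => w _ /=.
by rewrite !fctE /= !subr0.
Qed.

Lemma cov_mx_sym : (cov_mx P (X 0%N))^T = cov_mx P (X 0%N).
Proof. by apply/matrixP => i j; rewrite mxE !cov_mxE; apply: eq_Rintegral => w _; rewrite mulrC. Qed.

Lemma ae_sample_mean_cvg : {ae P, forall w, forall l,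
  n%:R^-1 * (\sum_(i < n) (X i w : 'rV[R]_d) 0 l) @[n --> \oo] --> 0}.
Proof.
apply: filter_forall => l.
have := strong_law X_iid (@measurable_coord R d l) (integrable_c l).
by rewrite expect_c.
Qed.

Lemma ae_sample_cov_cvg : {ae P, forall w, forall l l',
  n%:R^-1 * (\sum_(i < n) (X i w : 'rV[R]_d) 0 l * (X i w : 'rV[R]_d) 0 l')
    @[n --> \oo] --> cov_mx P (X 0%N) l l'}.
Proof.
apply: filter_forall => l; apply: filter_forall => l'; rewrite cov_mxE.
pose h (v : borel_rV R d) : R := (v : 'rV[R]_d) 0 l * (v : 'rV[R]_d) 0 l'.
have mh : measurable_fun setT h.
  by apply: measurable_funM; exact: measurable_coord.
exact: (strong_law X_iid mh (integrable_cc l l')).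
Qed.

(** A zero diagonal entry is a zero second moment, so every coordinate of the first observation
    vanishes almost surely; equality of laws transfers this to all observations, and countably many
    null sets are united. *)
Lemma ae_sample_eq0 : cov_mx P (X 0%N) = 0 ->
  {ae P, forall w, forall i, (X i w : 'rV[R]_d) = 0}.
Proof.
move=> G0.
have c0 l : P (X 0%N @^-1` [set v | (v : 'rV[R]_d) 0 l != 0]) = 0%E.
  have : (\int[P]_w `|(c 0 l w * c 0 l w)%:E| = 0)%E.
    transitivity (\int[P]_w (c 0 l w * c 0 l w)%:E)%E.
      by apply: eq_integral => w _; rewrite gee0_abs// lee_fin -expr2 sqr_ge0.
    have fcc := integrable_fin_num measurableT (integrable_cc l l).
    rewrite -(fineK fcc); congr EFin.
    by have := cov_mxE l l; rewrite G0 mxE.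
  have mcc : measurable_fun setT (fun w => (c 0 l w * c 0 l w)%:E).
    by apply/measurable_EFinP; exact: measurable_funM.
  move=> /(ae_eq_integral_abs _ measurableT mcc).1 [A [mA A0 hA]].
  apply/eqP; rewrite eq_le measure_ge0 andbT -A0; apply: le_measure; rewrite ?inE//.
    rewrite -[X in measurable X]setTI.
    have -> : X 0%N @^-1` [set v | (v : 'rV[R]_d) 0 l != 0] = c 0 l @^-1` (~` [set 0]).
      by apply/seteqP; split=> w /= /eqP.
    by apply: measurable_c => //; exact: measurableC.
  move=> w /= /eqP cw; apply: hA => /= /(_ I)[] /eqP.
  by rewrite mulf_eq0 orbb => /eqP.
have ci i l : {ae P, forall w, c i l w = 0}.
  have mB : measurable [set v : borel_rV R d | (v : 'rV[R]_d) 0 l != 0].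
    rewrite -[X in measurable X]setTI.
    have -> : [set v : borel_rV R d | (v : 'rV[R]_d) 0 l != 0] =
       (fun v : borel_rV R d => (v : 'rV[R]_d) 0 l) @^-1` (~` [set 0]).
      by apply/seteqP; split=> w /= /eqP.
    by apply: measurable_coord => //; exact: measurableC.
  exists (X i @^-1` [set v | (v : 'rV[R]_d) 0 l != 0]); split.
  - exact: measurable_funPTI.
  - by have [_ Xid] := X_iid; have := Xid i 0%N _ mB; rewrite /distribution /pushforward c0.
  - by move=> w /= cw; apply/eqP.
apply: ae_foralln => i.
have : {ae P, forall w, forall l, c i l w = 0} by apply: filter_forall => l; exact: ci.
by apply: filterS => w cw; apply/rowP => l; rewrite mxE; exact: cw.
Qed.

End sample_moments.

Theorem theorem1 (R : realType) (d : nat) (d_gt0 : (0 < d)%N)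
    (dO : measure_display) (Omega : measurableType dO)
    (P : probability Omega R)
    (X : nat -> {RV P >-> borel_rV R d})
    (X_iid : iid X)
    (X_centered : forall j : 'I_d,
       ('E_P[fun w => ((X 0%N w : 'rV[R]_d) 0 j)%R] = 0)%E)
    (X_sq_integrable :
       ('E_P[fun w => (enorm (X 0%N w : 'rV[R]_d) ^+ 2)%R] < +oo)%E)
    (lambda : 'I_d -> R)
    (lambda_eigen : eigenvalues_with_mult (cov_mx P (X 0%N)) lambda)
    (dN : measure_display) (OmegaN : measurableType dN)
    (PN : probability OmegaN R)
    (N : 'I_d -> {RV PN >-> R})
    (N_iid : iid N)
    (N_normal : forall i, standard_normal (N i))
    (dS : measure_display) (OmegaS : measurableType dS)
    (PS : probability OmegaS R)
    (idx : forall n : nat, 'I_n -> {RV PS >-> nat})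
    (idx_indep : forall n, mutually_independent (@idx n))
    (idx_unif : forall n (k : 'I_n), uniform_below n (idx n k)) :
  let Vstar n w : {RV PS >-> R} := boot_stat X idx n w in
  let V : {RV PN >-> R} := weighted_chi2 lambda N in
  {ae P, forall w, cvg_in_distribution (fun n => Vstar n w) V} /\
  {ae P, forall w,
    ereal_sup (range (fun x : R => `|cdf (Vstar n w) x - cdf V x|%E))
      @[n --> \oo] --> 0%E}.
Proof.
move=> Vstar V; have [N_indep _] := N_iid.
have [Q [QQ QGQ]] := real_spectral (cov_mx_sym X_centered) lambda_eigen.
(* Nonnegativity of the eigenvalues is deterministic, but it is read off from empirical limits at a
   good [w] and is therefore recorded inside the almost sure statement. *)
have lambda_weak : {ae P, forall w, (forall j, 0 <= lambda j) /\
    forall f : R -> R, continuous f -> (exists M : R, forall x, `|f x| <= M) ->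
    \int[PS]_ws f (Vstar n w ws) @[n --> \oo] --> \int[PN]_x f (V x)}.
  apply: filterS2 (ae_sample_mean_cvg X_iid X_centered X_sq_integrable)
    (ae_sample_cov_cvg X_iid X_centered X_sq_integrable) => w mean cov.
  have l0 j : 0 <= lambda j.
    exact: (@cov_eigenvalue_ge0 _ _ _ (fun i w => X i w) w _ _ _ cov QGQ).
  split=> // f cf bf.
  apply: laplace_continuity => //.
  - by move=> n ws; rewrite mulr_ge0// sqr_ge0.
  - by move=> x; apply: sumr_ge0 => j _; rewrite mulr_ge0// sqr_ge0.
  - move=> m; exact: (boot_laplace_cvg idx_indep idx_unif N_indep N_normal
      (X := fun i w => X i w) mean cov QQ QGQ).
split.
  apply: filterS lambda_weak => w [_ weak] f cf bf.
  have expE e (T : measurableType e) (M : probability T R) (Y : {RV M >-> R}) :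
      ('E_M[f \o Y] = (\int[M]_x f (Y x))%R%:E)%E.
    rewrite unlock EFin_expect//; split; last by have [b fb] := bf; exists b => x; exact: fb.
    by apply: measurableT_comp => //; exact: continuous_measurable_fun.
  under eq_fun do rewrite expE.
  by rewrite expE; apply/fine_cvgP; split; [exact: nearW|exact: weak].
have [[j lj]|l0] := pselect (exists j, lambda j != 0).
  apply: filterS lambda_weak => w [l_ge0 weak]; apply: polya => // x.
  by apply: (weighted_chi2_no_atom N_indep N_normal (j := j)); rewrite lt_neqAle eq_sym lj l_ge0.
have {}l0 j : lambda j = 0 by apply: contrapT => /eqP lj; apply: l0; exists j.
have cov0 : cov_mx P (X 0%N) = 0.
  (* Orthogonality gives Gamma = Q^T diag(lambda) Q, here 0. *)
  have QQ' := mulmx1C QQ.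
  rewrite -[LHS]mulmx1 -[LHS]mul1mx -QQ' !mulmxA -(mulmxA Q^T) -(mulmxA Q^T) QGQ.
  have -> : \row_i lambda i = 0 by apply/rowP => i; rewrite !mxE l0.
  by rewrite linear0 mulmx0 mul0mx.
apply: filterS (ae_sample_eq0 X_iid X_centered X_sq_integrable cov0) => w X0.
rewrite [X in X @ _ --> _](_ : _ = fun=> 0%E); first exact: cvg_cst.
apply/funext => n.
have V0 : V = cst 0 :> (_ -> _).
  by apply/funext => x; apply: big1 => i _; rewrite l0 mul0r.
have Vstar0 : Vstar n w = cst 0 :> (_ -> _).
  apply/funext => ws.
  have R0 k : resample X idx (n := n) k w ws = sample_mean X n w.
    rewrite /resample X0 /sample_mean big1 ?scaler0//.
  rewrite /Vstar /= /boot_stat /boot_mean /enorm big1 => [|j _].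
    by rewrite sqrtr0 expr0n mulr0.
  by rewrite big1 ?scaler0 ?mxE ?expr0n// => k _; rewrite R0 subrr.
have cdf_eq x : `|cdf (Vstar n w) x - cdf V x|%E = 0%E.
  rewrite /cdf /distribution /pushforward Vstar0 V0 !preimage_cst.
  by case: ifP => _; rewrite ?probability_setT ?measure0 subee ?abse0.
rewrite -[RHS]ereal_sup1; congr ereal_sup.
by apply/seteqP; split=> [_ [x _ <-]|_ ->] /=; [|exists 0].
Qed.
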